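(* For any integer $m\geq 2$ and any $c\in[0,1]$, we have $$\dim_H(\mathbf{F}_{m,c})\geq\frac{\sqrt{m(m^2-m+1)}}{\left(\frac{m+\sqrt{m(m^2-m+1)}}{m-1}\right)^2+\left(m-\frac1m\right)\left(\frac{m+\sqrt{m(m^2-m+1)}}{m-1}\right)-1}>0.$$ Asymptotically as $m\to\infty$, uniformly in $c\in(0,1]$, we have the stronger lower bound $$\dim_H(\mathbf{F}_{m,c})\geq\frac38 m-o(m).$$
   Context: $\dim_H$ denotes Hausdorff dimension. For $x\in\mathbb{R}$ let $\Vert x\Vert$ be the distance of $x$ to the nearest integer, and for $\underline{x}\in\mathbb{R}^m$ let $\Vert\underline{x}\Vert=\max_{1\leq i\leq m}\Vert x_i\Vert$. For $\underline{\xi}\in\mathbb{R}^m$ and $Q\geq 1$ let $\psi_{\underline{\xi}}(Q)=\min_{1\leq q\leq Q}\Vert q\underline{\xi}\Vert$, $q$ ranging over positive integers, and $\Theta(\underline{\xi})=\limsup_{Q\to\infty}Q^{1/m}\psi_{\underline{\xi}}(Q)$. Let $Di_m(c)$ be the set of $\underline{\xi}\in\mathbb{R}^m$ for which there is $Q_0$ with $\psi_{\underline{\xi}}(Q)\leq cQ^{-1/m}$ for all $Q\geq Q_0$, and $Bad_m=\{\underline{\xi}\in\mathbb{R}^m:\liminf_{Q\to\infty}Q^{1/m}\psi_{\underline{\xi}}(Q)>0\}$. For $c\in[0,1]$ define $$\mathbf{F}_{m,c}=\bigcap_{\epsilon>0}\big(Di_m(c+\epsilon)\setminus Di_m(c-\epsilon)\big)\setminus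 Bad_m=\{\underline{\xi}\in\mathbb{R}^m:\Theta(\underline{\xi})=c\}\setminus Bad_m.$$ *)

(* Defs.v *)
From HB Require Import structures.
From mathcomp Require Import all_boot all_order all_algebra.
From mathcomp Require Import all_classical all_reals all_analysis.

Import Order.TTheory GRing.Theory Num.Theory.
Import numFieldNormedType.Exports.

Local Open Scope classical_set_scope.
Local Open Scope ring_scope.

(* On 'rV[R]_m the norm is the max norm; it is equivalent to the Euclidean one,
   so the Hausdorff dimension is the usual one. *)
Section Hausdorff.
Context {R : realType} {V : normedModType R}.
Implicit Types (A : set V) (s d : R).
Local Open Scope ereal_scope.

(* [ereal_sup set0] is -oo, hence the [maxe 0]. *)
Definition diam A : \bar R :=
  maxe 0 (ereal_sup [set `|p.1 - p.2|%:E | p in A `*` A]).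

(* [0 `^ 0] is 1: the empty set is singled out so that the 0-dimensional
   measure counts points. *)
Definition diam_pow s A : \bar R := if A == set0 then 0 else diam A `^ s.

Definition hausdorff_content d s A : \bar R :=
  ereal_inf [set \sum_(0 <= i <oo) diam_pow s (U i) |
    U in [set U : nat -> set V |
      A `<=` \bigcup_i U i /\ forall i, diam (U i) <= d%:E]].

(* The supremum over d > 0 is the limit as d tends to 0, by monotonicity. *)
Definition hausdorff_measure s A : \bar R :=
  ereal_sup [set hausdorff_content d s A | d in [set d : R | (0 < d)%R]].

Definition hausdorff_dim A : \bar R :=
  ereal_inf [set s%:E | s in
    [set s : R | (0 <= s)%R /\ hausdorff_measure s A = 0]].

End Hausdorff.

Section Approximation.
Context {R : realType}.

Definition dist_int (x : R) : R := inf [set `|x - z%:~R| | z in [set: int]].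

Definition dist_ints {m} (x : 'rV[R]_m) : R :=
  \big[Num.max/0]_(i < m) dist_int (x 0 i).

(* The infimum of a finite set, nonempty for Q >= 1, hence a minimum. *)
Definition psi {m} (xi : 'rV[R]_m) (Q : R) : R :=
  inf [set dist_ints (q%:R *: xi) | q in [set q : nat | (1 <= q)%N /\ q%:R <= Q]].

Definition Theta {m} (xi : 'rV[R]_m) : \bar R :=
  limf_esup (fun Q : R => (Q `^ m%:R^-1 * psi xi Q)%:E) (pinfty_nbhs R).

Definition Di m (c : R) : set 'rV[R]_m :=
  [set xi | exists2 Q0 : R, 1 <= Q0 &
    forall Q, Q0 <= Q -> psi xi Q <= c * Q `^ (- m%:R^-1)].

Definition Bad m : set 'rV[R]_m :=
  [set xi | (0 <
    limf_einf (fun Q : R => (Q `^ m%:R^-1 * psi xi Q)%:E) (pinfty_nbhs R))%E].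

Definition Fset m (c : R) : set 'rV[R]_m :=
  (\bigcap_(e in [set e : R | 0 < e]) (Di m (c + e) `\` Di m (c - e))) `\` Bad m.

Lemma Di_le {m c} {xi : 'rV[R]_m} : Di m c xi -> (Theta xi <= c%:E)%E.
Proof.
move=> [Q0 Q01 H]; apply: ge_ereal_inf.
exists (ereal_sup [set (Q `^ m%:R^-1 * psi xi Q)%:E | Q in [set Q | Q0 < Q]]).
  by exists [set Q | Q0 < Q] => //; exists Q0; split; rewrite ?num_real.
apply: ge_ereal_sup => _ [Q /= /ltW Q0Q <-]; rewrite lee_fin.
have Qp : 0 < Q `^ m%:R^-1.
  by rewrite powR_gt0// (lt_le_trans ltr01)// (le_trans Q01).
rewrite mulrC -ler_pdivlMr//; apply: le_trans (H _ Q0Q) _.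
by rewrite powRN.
Qed.

Lemma Di_gt {m c} {xi : 'rV[R]_m} : (Theta xi < c%:E)%E -> Di m c xi.
Proof.
move=> /ereal_inf_lt[_ [W [Q0 [_ Q0W]] <-] Wc].
exists (Num.max (Q0 + 1) 1); first by rewrite le_max lexx orbT.
move=> Q; rewrite ge_max => /andP[Q0Q Q1].
have Qp : 0 < Q `^ m%:R^-1 by rewrite powR_gt0// (lt_le_trans ltr01).
rewrite powRN ler_pdivlMr// mulrC -lee_fin.
apply: le_trans (ltW Wc); apply: ereal_sup_ubound.
by exists Q => //; apply: Q0W; rewrite (lt_le_trans _ Q0Q)// ltrDl.
Qed.

Lemma FsetE m (c : R) :
  Fset m c = [set xi : 'rV[R]_m | Theta xi = c%:E] `\` Bad m.
Proof.
rewrite /Fset; congr (_ `\` _); apply/seteqP; split => xi /=.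
- move=> H; apply/eqP; rewrite eq_le; apply/andP; split.
    apply/lee_addgt0Pr => e e0; rewrite -EFinD.
    by have [+ _] := H e e0; exact: Di_le.
  rewrite leNgt; apply/negP => lt_c.
  have [r Tr rc] : exists2 r : R, (Theta xi < r%:E)%E & r < c.
    move: lt_c; case: (Theta xi) => [t|//|_].
      rewrite lte_fin => tc; exists ((t + c) / 2); last exact: (midf_lt tc).2.
      by rewrite lte_fin (midf_lt tc).1.
    by exists (c - 1); rewrite ?ltNyr// ltrBlDr ltrDl.
  have [|_] := H (c - r); first by rewrite /= subr_gt0.
  by apply; rewrite subKr; exact: Di_gt.
- move=> Tc e /= e0; split.
    by apply: Di_gt; rewrite Tc lte_fin ltrDl.
  move=> /Di_le; rewrite Tc lee_fin leNgt => /negP; apply.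
  by rewrite ltrBlDr ltrDl.
Qed.

Definition dim_bound (m : nat) : R :=
  let s := Num.sqrt (m%:R * (m%:R ^+ 2 - m%:R + 1)) in
  let t := (m%:R + s) / (m%:R - 1) in
  s / (t ^+ 2 + (m%:R - m%:R^-1) * t - 1).

End Approximation.

(* Main.v *)
Require Import Defs.
From HB Require Import structures.
From mathcomp Require Import all_boot all_order all_algebra.
From mathcomp Require Import all_classical all_reals all_analysis.
From mathcomp Require Import measurable_realfun.
From mathcomp Require Import ring lra zify.

Set Implicit Arguments.
Unset Strict Implicit.
Unset Printing Implicit Defensive.

Import Order.TTheory GRing.Theory Num.Theory.
Import numFieldNormedType.Exports.

Local Open Scope classical_set_scope.
Local Open Scope ring_scope.

(** The proof constructs, for given m and c, many vectors xi whose rational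
    approximations are controlled stage by stage.

    Stage l uses a power of two D (called den l), an integer T (step l) with
    D / T close to c ^ m, and A = D T^(m-1) (full l). Up to an error radius l,
    the vector xi is a rational point whose i-th coordinate, 0 <= i < m, has
    the denominator D T^i. Consequently D xi is within about 1 / T of an
    integer vector, while no q < A does essentially better: a q that does
    must be a multiple of D because of coordinate 0, then of D T because of
    coordinate 1, and finally of A (full_dvd). Hence psi(Q) is about 1 / T
    just below Q = A, where Q^(1/m) psi(Q) is about (A / T^m)^(1/m) =
    (D / T)^(1/m), which tends to c. The radius is so small that from A on
    the denominator A suffices until the next stage takes over, with
    Q^(1/m) psi(Q) tending to 0 there; so Theta(xi) = c and xi is not badly
    approximable (follows_Fset).

    There is much freedom. Coordinate i is a multiple of 2 / D chosen in the
    window left by the previous stage, moved by u / (D T^(i-1)) + 1 / (D T^i)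
    with 0 <= u < T^(i-2) arbitrary when i >= 2. The choices in different
    coordinates are independent, so the vectors xi form a product of Cantor
    sets on the line. Each of them is the image of [0, 1[ under a map x_i
    with |t - t'| <= B |x_i(t) - x_i(t')|^(s_i). A cover of the set of the xi
    then induces a cover of the unit cube by boxes, whose volumes add up to
    at least 1 (box_cover_weight), and this yields dimension at least the sum
    of the s_i (hausdorff_dim_ge_holder).

    It remains to choose the growth of the stages, D_(l+1) = D_l^(C m). If
    there are about D^y intervals when the multiple of 2 / D has been chosen,
    the recursion for the number of intervals allows every y below
    (C (m-1) - m) / (C m - 1). The exponent s_i is limited by two scales at
    which no choice has been made for a while: D^(-2) gives s_i < y / 2, and
    D^(-(m+C)) gives s_i < (y + max(0, i-2)) / (m + C) (Fset_dim_ge). For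
    C = (m + s) / (m - 1) with s = sqrt(m (m^2 - m + 1)) the value
    y / (m + C), used for all i, gives the first bound of the theorem. For
    C = sqrt m the exponents s_i come close to min(1/2, i/m), whose sum is
    3 m / 8 up to O(1); the total error is O(sqrt m). *)

(** * Covering the unit cube by boxes *)

Lemma interval_cover_weight (R : realType) (v a b : nat -> R)
    (v0 : forall j, 0 <= v j) (ab : forall j, a j <= b j)
    (cov : forall s, 0 <= s < 1 ->
      (1 <= \sum_(0 <= j <oo) (v j * \1_(`[a j, b j]%classic : set R) s)%:E)%E) :
  (1 <= \sum_(0 <= j <oo) (v j * (b j - a j))%:E)%E.
Proof.
pose D : set R := `[0, 1[%classic.
have mD : measurable D by exact: measurable_itv.
pose F j s : \bar R := (v j * \1_(`[a j, b j]%classic : set R) s)%:E.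
have F0 j s : (0 <= F j s)%E by rewrite lee_fin mulr_ge0.
have mF j : measurable_fun D (F j).
  apply/measurable_EFinP; apply: measurable_funM; first exact: measurable_cst.
  by apply: measurable_indic; exact: measurable_itv.
have D1 : lebesgue_measure D = 1%E.
  by rewrite /D lebesgue_measure_itv/= lte_fin ltr01 oppr0 adde0.
have one : (1 = \int[lebesgue_measure]_(x in D) (cst 1 x : \bar R))%E.
  by rewrite integral_cst// mul1e; exact: esym D1.
rewrite [leLHS]one.
apply: (@le_trans _ _ (\int[lebesgue_measure]_(x in D) \sum_(0 <= j <oo) F j x)%E).
  apply: ge0_le_integral => //.
  by apply: ge0_emeasurable_sum => // j _; exact: mF.
rewrite integral_nneseries//; apply: lee_nneseries => [j _ _|j _].
  by apply: integral_ge0.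
pose G (x : R) : \bar R := (\1_(`[a j, b j]%classic : set R) x)%:E.
have mG : measurable_fun D G.
  by apply/measurable_EFinP; apply: measurable_indic; exact: measurable_itv.
under eq_integral do rewrite /F EFinM -/(G _).
rewrite ge0_integralZl ?lee_fin// => [|x _]; last by rewrite lee_fin.
rewrite integral_indic// EFinM lee_wpmul2l ?lee_fin//.
apply: (@le_trans _ _ (lebesgue_measure (`[a j, b j]%classic : set R))).
  by apply: le_measure; rewrite ?inE//; exact: measurableI.
rewrite lebesgue_measure_itv/= lte_fin; case: ifP => // _.
by rewrite lee_fin subr_ge0.
Qed.

(** The cover is described by weights so that one coordinate can be integrated
    out at a time: the length of the last side of a box becomes a factor of
    its weight. *)
Lemma box_cover_weight (R : realType) (m : nat) (w : nat -> R) (a b : nat -> nat -> R)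
    (w0 : forall j, 0 <= w j) (ab : forall j i, a j i <= b j i)
    (cov : forall t : nat -> R, (forall i, 0 <= t i < 1) ->
      (1 <= \sum_(0 <= j <oo)
        (w j * \prod_(i < m) \1_(`[a j i, b j i]%classic : set R) (t i))%:E)%E) :
  (1 <= \sum_(0 <= j <oo) (w j * \prod_(i < m) (b j i - a j i))%:E)%E.
Proof.
elim: m w w0 cov => [|m IHm] w w0 cov.
  have := cov (fun=> 0); rewrite lexx ltr01 => /(_ (fun=> isT)).
  by congr (_ <= limn _)%E; apply/funext => n; apply: eq_bigr => j _; rewrite !big_ord0.
have E j : (w j * \prod_(i < m.+1) (b j i - a j i))%:E =
    (w j * (b j m - a j m) * \prod_(i < m) (b j i - a j i))%:E.
  by rewrite big_ord_recr /= mulrA mulrAC.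
rewrite (eq_eseriesr (fun j _ => E j)) {E}.
apply: IHm => [j|t t01]; first by rewrite mulr_ge0// subr_ge0.
have E j : (w j * (b j m - a j m) * \prod_(i < m)
      \1_(`[a j i, b j i]%classic : set R) (t i))%:E =
    (w j * \prod_(i < m) \1_(`[a j i, b j i]%classic : set R) (t i) *
      (b j m - a j m))%:E.
  by rewrite mulrAC.
rewrite (eq_eseriesr (fun j _ => E j)) {E}.
apply: interval_cover_weight => // [j|s s01].
  by rewrite mulr_ge0// prodr_ge0.
have E j : (w j * \prod_(i < m) \1_(`[a j i, b j i]%classic : set R) (t i) *
      \1_(`[a j m, b j m]%classic : set R) s)%:E =
    (w j * \prod_(i < m.+1) \1_(`[a j i, b j i]%classic : set R)
      (if i == m :> nat then s else t i))%:E.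
  rewrite big_ord_recr /= eqxx mulrA; congr (_ * _ * _)%:E.
  by apply: eq_bigr => i _; rewrite ltn_eqF.
rewrite (eq_eseriesr (fun j _ => E j)).
by apply: (cov (fun i => if i == m then s else t i)) => i; case: ifP.
Qed.

(** * Lower bounds for the Hausdorff dimension *)

Lemma powR_sum (R : realType) (r : R) (m : nat) (s : nat -> R) :
  (forall i, 0 <= s i) -> 0 <= r ->
  \prod_(i < m) r `^ s i = r `^ (\sum_(i < m) s i).
Proof.
move=> s0 r0; elim: m => [|m IHm]; first by rewrite !big_ord0 powRr0.
rewrite !big_ord_recr /= IHm.
have S0 : 0 <= \sum_(i < m) s i by exact: sumr_ge0.
have [->|rn0] := eqVneq r 0; last by rewrite powRD// rn0 implybT.
have [E|n0] := eqVneq (\sum_(i < m) s i + s m) 0.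
  move/eqP: E; rewrite paddr_eq0// => /andP[/eqP -> /eqP ->].
  by rewrite addr0 !powRr0 mulr1.
rewrite [RHS]powR0//; move: n0; rewrite paddr_eq0// negb_and => /orP[] n0.
  by rewrite (powR0 n0) mul0r.
by rewrite (powR0 n0) mulr0.
Qed.

Lemma le_norm_rV (R : realType) (m : nat) (x : 'rV[R]_m) (i : 'I_m) :
  `|x 0 i| <= `|x|.
Proof.
by rewrite [leRHS]/Num.norm /= mx_normrE; apply/bigmax_geP; right => /=; exists (0, i).
Qed.

Lemma le_diam (R : realType) (V : normedModType R) (U : set V) (p q : V) :
  U p -> U q -> (`|p - q|%:E <= diam U)%E.
Proof.
move=> Up Uq; rewrite /diam le_max; apply/orP; right.
by apply: ereal_sup_ubound; exists (p, q).
Qed.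

Lemma diam_ge0 (R : realType) (V : normedModType R) (U : set V) : (0 <= diam U)%E.
Proof. by rewrite /diam le_max lexx. Qed.

Lemma diam_pow_ge0 (R : realType) (V : normedModType R) (U : set V) (s : R) :
  (0 <= diam_pow s U)%E.
Proof. by rewrite /diam_pow; case: ifP => // _; exact: poweR_ge0. Qed.

(** For sets of diameter at most 1 the sum grows when the exponent decreases,
    so that a positive lower bound for the exponent S rules out measure zero
    for all smaller exponents. *)
Lemma hausdorff_dim_ge (R : realType) (V : normedModType R) (A : set V) (S B : R) :
  0 < B ->
  (forall U : nat -> set V, A `<=` \bigcup_i U i ->
    (forall i, (diam (U i) <= 1%:E)%E) ->
    (1 <= \sum_(0 <= i <oo) B%:E * diam_pow S (U i))%E) ->
  (S%:E <= hausdorff_dim A)%E.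
Proof.
move=> B0 H; apply: le_ereal_inf_tmp => _ [s [s0 hs0] <-].
rewrite lee_fin leNgt; apply/negP => sS.
have c0 : (hausdorff_content 1 s A <= 0)%E.
  by rewrite -hs0; apply: ereal_sup_ubound; exists 1 => //=; exact: ltr01.
have /ereal_inf_lt[_ [U [cU dU] <-] lt1] : (hausdorff_content 1 s A < B^-1%:E)%E.
  by rewrite (le_lt_trans c0)// lte_fin invr_gt0.
have := H _ cU dU; apply/negP; rewrite -ltNge.
rewrite nneseriesZl; last by move=> *; exact: diam_pow_ge0.
have : (\sum_(0 <= i <oo) diam_pow S (U i) < B^-1%:E)%E.
  apply: le_lt_trans lt1; apply: lee_nneseries => [*|i _]; first exact: diam_pow_ge0.
  rewrite /diam_pow; case: ifP => // _.
  have := dU i; have := diam_ge0 (U i).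
  case: (diam (U i)) => // r; rewrite !lee_fin => r0 r1.
  have [->|rn0] := eqVneq r 0.
    by rewrite powR0 ?powR_ge0// gt_eqF// (le_lt_trans s0).
  by apply: ger_powR; [rewrite r1 lt_def rn0 r0|exact: ltW].
by rewrite -(@lte_pmul2l _ B%:E)// -EFinM divff// gt_eqF.
Qed.

(** A set of diameter r is hit by x only for parameters in a box with sides
    2 B r^(s i). These boxes cover the unit cube, so their volumes
    (2 B)^m r^(\sum s i) add up to at least 1. *)
Lemma hausdorff_dim_ge_holder (R : realType) (m : nat) (A : set 'rV[R]_m)
    (s : nat -> R) (B : R) (x : nat -> R -> R) :
  0 < B -> (forall i, 0 <= s i) ->
  (forall i t t', (i < m)%N -> 0 <= t < 1 -> 0 <= t' < 1 ->
     `|t - t'| <= B * `|x i t - x i t'| `^ s i) ->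
  (forall t : nat -> R, (forall i, 0 <= t i < 1) -> A (\row_(i < m) x i (t i))) ->
  ((\sum_(i < m) s i)%:E <= hausdorff_dim A)%E.
Proof.
move=> B0 s0 hold inA.
apply: (@hausdorff_dim_ge _ _ _ _ ((2 * B) ^+ m)) => [|U cU dU].
  by rewrite exprn_gt0// mulr_gt0.
pose r j := fine (diam (U j)).
have rE j : diam (U j) = (r j)%:E.
  by rewrite fineK// ge0_fin_numE ?diam_ge0// (le_lt_trans (dU j))// ltry.
have r0 j : 0 <= r j by rewrite -lee_fin -rE diam_ge0.
pose good j (t : nat -> R) :=
  (forall i, 0 <= t i < 1) /\ U j (\row_(i < m) x i (t i)).
have /choice[tj tjP] : forall j, exists t, (exists t', good j t') -> good j t.
  move=> j; have [[t' gt']|ng] := pselect (exists t', good j t').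
    by exists t'.
  by exists (fun=> 0).
(* Sets that miss the image of x get weight 0; the box of any other set is
   centred at some parameter that x sends into it. *)
pose w j : R := if `[< exists t', good j t' >] then 1 else 0.
pose h j i := B * r j `^ s i.
have h0 j i : 0 <= h j i by rewrite mulr_ge0 ?powR_ge0// ltW.
have w0 j : 0 <= w j by rewrite /w; case: ifP.
have := @box_cover_weight R m w (fun j i => tj j i - h j i) (fun j i => tj j i + h j i) w0.
move=> /(_ _ _)/le_trans; apply.
- by move=> j i; rewrite lerBlDr -addrA lerDl addr_ge0.
- move=> t t01.
  have [j _ Uj] := cU _ (inA t t01).
  have gj : exists t', good j t' by exists t.
  pose F j := (w j * \prod_(i < m)
    \1_(`[tj j i - h j i, tj j i + h j i]%classic : set R) (t i))%:E.
  have F0 k : (0 <= F k)%E by rewrite lee_fin mulr_ge0// prodr_ge0.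
  apply: (@le_trans _ _ (\sum_(0 <= k < j.+1) F k)%E); last first.
    exact: nneseries_lim_ge.
  rewrite big_nat_recr //= (@le_trans _ _ (F j))//; last first.
    by rewrite leeDr// sume_ge0.
  rewrite /F /w asboolT// mul1r big1// => i _.
  rewrite indicE mem_set//= in_itv /=.
  have [tj01 Utj] := tjP j gj.
  have : `|t i - tj j i| <= h j i.
    apply: le_trans (hold i _ _ (ltn_ord i) (t01 i) (tj01 i)) _.
    rewrite ler_pM2l// ge0_ler_powR ?nnegrE// -lee_fin -rE.
    apply: le_trans (le_diam Uj Utj); rewrite lee_fin.
    by apply: le_trans (le_norm_rV _ i); rewrite !mxE.
  by rewrite ler_distl => /andP[-> ->].
- apply: lee_nneseries => [j _ _|j _].
    rewrite lee_fin mulr_ge0// prodr_ge0// => i _.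
    by rewrite subr_ge0 lerBlDr -addrA lerDl addr_ge0.
  rewrite /w; case: asboolP => [[t [t01 Ut]]|_]; last first.
    by rewrite mul0r mule_ge0// ?diam_pow_ge0// lee_fin exprn_ge0// mulr_ge0// ltW.
  rewrite mul1r /diam_pow ifF; last first.
    by apply/negbTE/set0P; eexists; exact: Ut.
  rewrite rE /= -EFinM lee_fin -powR_sum// -[X in _ ^+ X]card_ord -prodr_const.
  rewrite -big_split /=; apply: ler_prod => i _.
  by have := h0 j i; rewrite /h => hji; apply/andP; split; lra.
Qed.

(** * Cantor maps on the line *)

Section CantorMap.
Context {R : realType}.
Variables (M : nat -> nat) (sg r : nat -> R) (g : nat -> R -> R).

Definition cells k : nat := (\prod_(j < k) M j)%N.

(** Left end of the n-th interval of level k, of length r k. It has M k children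
    in consecutive positions at distance sg k. The position of the first child
    is a function g k of the left end of its parent, which leaves room for
    moving it to a prescribed grid. *)
Fixpoint left_end k n : R :=
  if k is k'.+1 then
    g k' (left_end k' (n %/ M k')%N) + (n %% M k')%:R * sg k'
  else 0.

(** The n-th interval of level k corresponds to the n-th of the cells k equal
    parts of [0, 1[. *)
Definition cell_index k (t : R) : nat := Num.truncn (t * (cells k)%:R).

Definition cell_left k t : R := left_end k (cell_index k t).

Definition cantor_map t : R := sup (range (cell_left ^~ t)).

Hypothesis M_gt0 : forall k, (0 < M k)%N.
Hypothesis sg_gt0 : forall k, 0 < sg k.
Hypothesis r_ge0 : forall k, 0 <= r k.
Hypothesis g_ge : forall k x, x <= g k x.
Hypothesis g_le : forall k x, g k x + (M k)%:R * sg k <= x + r k.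
Hypothesis r_le : forall k, 2 * r k.+1 <= sg k.

Lemma cellsS k : cells k.+1 = (cells k * M k)%N.
Proof. by rewrite /cells big_ord_recr. Qed.

Lemma cells_gt0 k : (0 < cells k)%N.
Proof. by rewrite prodn_gt0. Qed.

Lemma cell_index_itv k t : 0 <= t ->
  (cell_index k t)%:R <= t * (cells k)%:R < (cell_index k t).+1%:R.
Proof. by move=> t0; apply: truncn_itv; rewrite mulr_ge0. Qed.

Lemma cell_indexS k t : 0 <= t ->
  (cell_index k.+1 t %/ M k)%N = cell_index k t.
Proof.
move=> t0; have /andP[lo hi] := cell_index_itv k.+1 t0.
apply/esym/truncn_def; apply/andP; split.
- have : ((cell_index k.+1 t %/ M k)%N * M k)%:R <= t * (cells k.+1)%:R.
    by apply: le_trans lo; rewrite ler_nat leq_trunc_div.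
  by rewrite cellsS !natrM mulrA ler_pM2r ?ltr0n.
- have : t * (cells k.+1)%:R < ((cell_index k.+1 t %/ M k).+1 * M k)%:R.
    by apply: lt_le_trans hi _; rewrite ler_nat ltn_ceil.
  by rewrite cellsS !natrM mulrA ltr_pM2r ?ltr0n.
Qed.

Lemma cell_leftS k t : 0 <= t ->
  cell_left k.+1 t =
    g k (cell_left k t) + (cell_index k.+1 t %% M k)%:R * sg k.
Proof. by move=> t0; rewrite /cell_left /= cell_indexS. Qed.

Lemma cell_left_itv k t : 0 <= t ->
  cell_left k t <= cell_left k.+1 t /\
  cell_left k.+1 t + r k.+1 <= cell_left k t + r k.
Proof.
move=> t0; rewrite cell_leftS//; set x := cell_left k t; set d := (_ %% _)%N.
have := g_ge k x; have := g_le k x; have := r_le k; have := sg_gt0 k.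
have := r_ge0 k.+1.
have d0 : 0 <= d%:R * sg k by rewrite mulr_ge0// ltW.
have : (d.+1)%:R * sg k <= (M k)%:R * sg k.
  by rewrite ler_pM2r// ler_nat ltn_mod.
by rewrite -natr1 mulrDl mul1r; move=> *; split; lra.
Qed.

Lemma cell_left_mono j k t : 0 <= t -> (j <= k)%N ->
  cell_left j t <= cell_left k t /\
  cell_left k t + r k <= cell_left j t + r j.
Proof.
move=> t0; elim: k => [|k IHk]; first by rewrite leqn0 => /eqP ->.
rewrite leq_eqVlt => /predU1P[->//|]; rewrite ltnS => /IHk[h1 h2].
have [h3 h4] := cell_left_itv k t0.
by split; [exact: le_trans h3|exact: le_trans h2].
Qed.

Lemma cantor_map_itv k t : 0 <= t ->
  cell_left k t <= cantor_map t <= cell_left k t + r k.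
Proof.
move=> t0; have ub j : cell_left j t <= cell_left k t + r k.
  have [jk|/ltnW kj] := leqP j k.
    have [h _] := cell_left_mono t0 jk.
    by rewrite (le_trans h)// lerDl.
  have [_ h] := cell_left_mono t0 kj.
  by apply: le_trans h; rewrite lerDl.
apply/andP; split; last first.
  by apply: sup_le_ub => [|_ [j _ <-]//]; exists (cell_left k t), k.
apply: ub_le_sup; last by exists k.
by exists (cell_left k t + r k) => _ [j _ <-].
Qed.

(** Since intervals are at most half as long as their spacing, siblings that are
    j steps apart contain points at distance at least j * sg k / 2 only, while
    the parameters differ by at most j + 1 <= 2 * j parts of [0, 1[. *)
Lemma cantor_map_sep k t t' : 0 <= t -> t < t' ->
  cell_index k t = cell_index k t' -> cell_index k.+1 t != cell_index k.+1 t' ->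
  exists2 j : nat, (0 < j <= M k)%N &
    (t' - t) * (cells k.+1)%:R <= 2 * j%:R /\
    j%:R * sg k <= 2 * `|cantor_map t - cantor_map t'|.
Proof.
move=> t0 tt' eqk neqk; have t'0 : 0 <= t' by rewrite (le_trans t0)// ltW.
set n := cell_index k.+1 t in neqk *; set n' := cell_index k.+1 t' in neqk *.
have nn' : (n < n')%N.
  rewrite ltn_neqAle neqk; apply: le_truncn.
  by rewrite ler_pM2r ?ltr0n ?cells_gt0// ltW.
have eqd : (n %/ M k = n' %/ M k)%N by rewrite !cell_indexS.
have dE : (n' %% M k = n %% M k + (n' - n))%N.
  by have := divn_eq n (M k); have := divn_eq n' (M k); rewrite eqd; lia.
have dM : (n' %% M k < M k)%N by rewrite ltn_mod.
exists (n' - n)%N; first by apply/andP; split; lia.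
split.
- have /andP[lo _] := cell_index_itv k.+1 t0.
  have /andP[_ hi] := cell_index_itv k.+1 t'0.
  rewrite -/n in lo; rewrite -/n' -natr1 in hi.
  have : (1 : R) <= (n' - n)%:R by rewrite ler1n subn_gt0.
  by rewrite natrB ?(ltnW nn')//; lra.
- have /andP[_ h1] := cantor_map_itv k.+1 t0.
  have /andP[h2 _] := cantor_map_itv k.+1 t'0.
  have l1 := cell_leftS k t0; have l2 := cell_leftS k t'0.
  rewrite -/n in l1; rewrite -/n' dE natrD mulrDl in l2.
  have e : cell_left k t = cell_left k t' by rewrite /cell_left eqk.
  have j1 : sg k <= (n' - n)%:R * sg k.
    by rewrite ler_peMl ?(ltW (sg_gt0 _))// ler1n subn_gt0.
  rewrite distrC; apply: le_trans (ler_wpM2l _ (ler_norm _)) => //.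
  by have := r_le k; rewrite e in l1; lra.
Qed.

(** Among j out of M k siblings, the bound with exponent s is the most demanding
    for j = M k, because j / M k <= (j / M k)^s when s <= 1. So one inequality
    per level suffices, comparing the number of intervals with the room that
    their children occupy. *)
Lemma cantor_map_holder (c s : R) : 0 <= c -> 0 < s <= 1 ->
  (forall k, 1 <= c * (cells k)%:R * ((M k)%:R * sg k) `^ s) ->
  forall t t', 0 <= t < 1 -> 0 <= t' < 1 ->
    `|t - t'| <= 4 * c * `|cantor_map t - cantor_map t'| `^ s.
Proof.
move=> c0 /andP[s0 s1] hc t t' t01 t'01.
wlog tt' : t t' t01 t'01 / t < t'.
  move=> W; have [tt'|tt'|->] := ltgtP t t'; first exact: W.
    by rewrite distrC [X in X `^ _]distrC; exact: W.
  by rewrite subrr normr0 !mulr_ge0 ?powR_ge0.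
have /andP[t0 t1] := t01; have /andP[t'0 t'1] := t'01.
have [k eqk neqk] : exists2 k, cell_index k t = cell_index k t' &
    cell_index k.+1 t != cell_index k.+1 t'.
  (* Otherwise t' - t would be at most 1 / cells k for all k, and hc makes
     cells k grow at least like r k ^ (- s), where r k <= r 0 / 2 ^ k. *)
  have [k nk] : exists k, cell_index k t != cell_index k t'.
    apply: contrapT => /forallNP alleq.
    have small k : (t' - t) * (cells k)%:R <= 1.
      have /andP[lo _] := cell_index_itv k t0.
      have /andP[_ hi] := cell_index_itv k t'0.
      have /negP/negPn/eqP e := alleq k.
      by rewrite e in lo; rewrite -natr1 in hi; lra.
    have rk k : r k <= 2 ^- k * r 0.
      elim: k => [|k IHk]; first by rewrite expr0 invr1 mul1r.
      have := r_le k; have := g_ge k 0; have := g_le k 0.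
      have : sg k <= (M k)%:R * sg k by rewrite ler_peMl ?(ltW (sg_gt0 _))// ler1n.
      by rewrite exprS invfM; lra.
    have Mr k : (M k)%:R * sg k <= r k.
      by have := g_ge k 0; have := g_le k 0; lra.
    have key k : t' - t <= c * (2 ^- k * r 0) `^ s.
      have h1 := hc k; have h2 := small k.
      have ck : 0 < (cells k)%:R :> R by rewrite ltr0n cells_gt0.
      rewrite -(ler_pM2r ck); apply: le_trans h2 _; apply: le_trans h1 _.
      rewrite mulrAC ler_wpM2r// ler_wpM2l// ge0_ler_powR ?nnegrE ?mulr_ge0//.
      - exact: ltW.
      - exact: ltW.
      - by rewrite (le_trans (Mr k)).
    have q01 : `|2 `^ (- s) : R| < 1.
      rewrite ger0_norm ?powR_ge0// -[ltRHS](powRr0 2) /powR ifF ?gt_eqF//.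
      by rewrite ltr_expR ltr_pM2r ?oppr_lt0// ln_gt0// ltr1n.
    have cvg0 : (2 `^ (- s) : R) ^+ k * (c * r 0 `^ s) @[k --> \oo] --> (0 : R).
      rewrite -[0 in X in _ --> X](mul0r (c * r 0 `^ s)).
      by apply: cvgM; [exact: cvg_expr|exact: cvg_cst].
    have d0 : 0 < t' - t by rewrite subr_gt0.
    have [k _ /(_ k (leqnn k)) /=] := cvgr_lt 0 cvg0 (t' - t) d0.
    apply/negP; rewrite -leNgt; apply: le_trans (key k) _.
    rewrite powRM ?r_ge0 ?invr_ge0// mulrCA.
    have -> : (2 ^- k) `^ s = (2 `^ (- s)) ^+ k :> R.
      by rewrite -powR_invn// -powRrM mulNr mulrC -mulNr powRrM powR_mulrn// powR_ge0.
    exact: lexx.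
  elim: k nk => [|k IHk] nk.
    suff e0 u : 0 <= u < 1 -> cell_index 0 u = 0%N by rewrite !e0 ?eqxx in nk.
    move=> u01; apply: truncn_def; rewrite /cells big_ord0 mulr1.
    by case/andP: u01 => -> ->.
  have [e|/IHk//] := eqVneq (cell_index k t) (cell_index k t').
  by exists k.
have [j /andP[j0 jM] [h1 h2]] := cantor_map_sep t0 tt' eqk neqk.
set x : R := `|_ - _| in h2 *.
rewrite distrC ger0_norm ?subr_ge0; last exact: ltW.
have Mk : 0 < (M k)%:R :> R by rewrite ltr0n.
have ck : 0 < (cells k)%:R :> R by rewrite ltr0n cells_gt0.
have ck1 : 0 < (cells k.+1)%:R :> R by rewrite ltr0n cells_gt0.
rewrite -(ler_pM2r ck1); apply: le_trans h1 _.
rewrite cellsS natrM mulrA.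
have jM1 : 0 < (j%:R / (M k)%:R : R) <= 1.
  by rewrite divr_gt0 ?ltr0n// ler_pdivrMr// mul1r ler_nat.
have p1 : j%:R / (M k)%:R <= (j%:R / (M k)%:R) `^ s.
  by apply: ger1_powR.
have p2 : (j%:R * sg k) `^ s = (j%:R / (M k)%:R) `^ s * ((M k)%:R * sg k) `^ s.
  rewrite -powRM ?mulr_ge0 ?invr_ge0 ?(ltW (sg_gt0 _))//.
  by congr (_ `^ _); field; rewrite gt_eqF.
have p3 : (j%:R * sg k) `^ s <= 2 * x `^ s.
  apply: (@le_trans _ _ ((2 * x) `^ s)).
    by rewrite ge0_ler_powR ?nnegrE ?mulr_ge0 ?(ltW (sg_gt0 _)) ?(ltW s0) ?normr_ge0.
  rewrite powRM ?normr_ge0// ler_wpM2r ?powR_ge0// -[leRHS]powRr1//.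
  by rewrite ler_powR// ler1n.
have := hc k; have := powR_ge0 x s; move: p1 p2 p3.
set p := (j%:R / (M k)%:R) `^ s; set q := ((M k)%:R * sg k) `^ s.
move=> p1 p2 p3 x0 hk.
have p0 : 0 <= p by exact: powR_ge0.
have -> : 2 * j%:R = 2 * (j%:R / (M k)%:R) * (M k)%:R :> R.
  by field; rewrite gt_eqF.
rewrite ler_pM2r//.
apply: (@le_trans _ _ (2 * p * (c * (cells k)%:R * q))).
  rewrite -[leLHS]mulr1 ler_pM ?mulr_ge0 ?invr_ge0// ler_wpM2l//.
rewrite p2 in p3.
rewrite [leLHS](_ : _ = (2 * c * (cells k)%:R) * (p * q)); last by ring.
apply: le_trans (ler_wpM2l _ p3) _; first by rewrite !mulr_ge0.
by rewrite le_eqVlt; apply/orP; left; apply/eqP; ring.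
Qed.

End CantorMap.

(** * Distances to integers *)

Lemma dist_int_le (R : realType) (x : R) (z : int) : dist_int x <= `|x - z%:~R|.
Proof.
apply: ge_inf; last by exists z.
by exists 0 => _ [w _ <-].
Qed.

Lemma dist_int_ge (R : realType) (x r : R) :
  (forall z : int, r <= `|x - z%:~R|) -> r <= dist_int x.
Proof.
move=> H; apply: lb_le_inf; first by exists `|x - 0%:~R|, 0.
by move=> _ [z _ <-].
Qed.

Lemma dist_ints_le (R : realType) (m : nat) (x : 'rV[R]_m) (r : R) : 0 <= r ->
  (forall i, exists z : int, `|x 0 i - z%:~R| <= r) -> dist_ints x <= r.
Proof.
move=> r0 H; apply: bigmax_le => // i _; have [z hz] := H i.
exact: le_trans (dist_int_le _ z) hz.
Qed.

Lemma dist_ints_ge (R : realType) (m : nat) (x : 'rV[R]_m) (r : R) (i : 'I_m) :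
  (forall z : int, r <= `|x 0 i - z%:~R|) -> r <= dist_ints x.
Proof.
by move=> H; apply/bigmax_geP; right; exists i => //; exact: dist_int_ge.
Qed.

Lemma dist_ints_ge0 (R : realType) (m : nat) (x : 'rV[R]_m) : 0 <= dist_ints x.
Proof. by apply/bigmax_geP; left. Qed.

Lemma psi_le (R : realType) (m : nat) (xi : 'rV[R]_m) (Q r : R) (q : nat) :
  (1 <= q)%N -> q%:R <= Q -> 0 <= r ->
  (forall i, exists z : int, `|q%:R * xi 0 i - z%:~R| <= r) -> psi xi Q <= r.
Proof.
move=> q1 qQ r0 H; apply: (@le_trans _ _ (dist_ints (q%:R *: xi))).
  apply: ge_inf; last by exists q.
  by exists 0 => _ [p _ <-]; exact: dist_ints_ge0.
by apply: dist_ints_le => // i; rewrite mxE.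
Qed.

Lemma psi_ge (R : realType) (m : nat) (xi : 'rV[R]_m) (Q r : R) : 1 <= Q ->
  (forall q : nat, (1 <= q)%N -> q%:R <= Q ->
     exists i, forall z : int, r <= `|q%:R * xi 0 i - z%:~R|) -> r <= psi xi Q.
Proof.
move=> Q1 H; apply: lb_le_inf; first by exists (dist_ints (1%:R *: xi)), 1%N.
move=> _ [q [q1 qQ] <-]; have [i hi] := H q q1 qQ.
by apply: (@dist_ints_ge _ _ _ _ i) => z; rewrite mxE.
Qed.

Lemma le_mul_powRN (R : realType) (m : nat) (x y Q : R) : (0 < m)%N -> 0 < Q ->
  0 <= x -> 0 <= y -> x ^+ m * Q <= y ^+ m <-> x <= y * Q `^ (- m%:R^-1).
Proof.
move=> m0 Q0 x0 y0; rewrite powRN.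
have rt : Q `^ m%:R^-1 ^+ m = Q.
  by rewrite -powR_mulrn ?powR_ge0// -powRrM mulVf ?powRr1 ?(ltW Q0)// pnatr_eq0 gtn_eqF.
have q0 : 0 < Q `^ m%:R^-1 by rewrite powR_gt0.
rewrite ler_pdivlMr// -[in x ^+ m * Q]rt -exprMn.
by rewrite ler_pXn2r ?nnegrE ?mulr_ge0// ltW.
Qed.

Lemma int_lt1_eq0 (R : realType) (z : int) : `|z%:~R : R| < 1 -> z = 0.
Proof. by rewrite -intr_norm ltrz1 => h; apply/eqP; rewrite -absz_eq0; lia. Qed.

(** * The Diophantine construction *)

Section Construction.
Context {R : realType}.
Variables (m : nat) (c : R) (k : nat -> nat).

Definition base l : nat := (2 ^ k l)%N.
Definition den l : nat := (base l ^ m)%N.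

(** The limit c ^ m, kept positive when c = 0 by a term that tends to 0. *)
Definition ratio l : R := Num.max (c ^+ m) (k l)%:R^-1.
Definition step l : nat := Num.truncn ((den l)%:R / ratio l).
Definition full l : nat := (den l * step l ^ m.-1)%N.

(** Chosen so that full l * radius l = 1 / (base l.+1 * k l): since base l.+1 is
    the m-th root of den l.+1, the denominator full l remains good, with a
    factor 1 / k l to spare, for all Q up to den l.+1. *)
Definition radius l : R := (full l * base l.+1 * k l)%:R^-1.

(** The i-th coordinate of a rational point of stage l. In its use u is below
    step l ^ (i - 2), a truncated subtraction: the last term vanishes for
    i < 2, and the last two terms add up to at most 1 / (den l * step l) for
    i >= 1. For i = 0 the node is an odd multiple of 1 / den l. *)
Definition node l i (z : int) (u : nat) : R :=
  2 * z%:~R / (den l)%:R + ((den l * step l ^ i)%:R)^-1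
  + u%:R / (den l * (step l * step l ^ (i - 2)))%:R.

Definition follows (xi : 'rV[R]_m) := forall l (i : 'I_m), exists z u,
  (u < step l ^ (i - 2))%N /\ node l i z u <= xi 0 i <= node l i z u + radius l.

Hypothesis m_ge2 : (2 <= m)%N.
Hypothesis c01 : 0 <= c <= 1.
Hypothesis k0 : (0 < k 0)%N.
Hypothesis kS : forall l, (m.+1 * k l <= k l.+1)%N.

Lemma k_gt l : (l < k l)%N.
Proof. by elim: l => // l IHl; move: IHl (kS l) m_ge2; clear; nia. Qed.

Lemma k_gt0 l : (0 < k l)%N.
Proof. exact: leq_ltn_trans (k_gt l). Qed.

Lemma base_gt0 l : (0 < base l)%N.
Proof. by rewrite expn_gt0. Qed.

Lemma den_gt0 l : (0 < den l)%N.
Proof. by rewrite expn_gt0 base_gt0. Qed.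

Lemma k_lt_base l : (k l < base l)%N.
Proof. exact: ltn_expl. Qed.

Lemma base_le_den l : (base l <= den l)%N.
Proof. by rewrite /den -{1}[base l]expn1 leq_pexp2l ?base_gt0//; lia. Qed.

Lemma ratio_gt0 l : 0 < ratio l.
Proof. by rewrite lt_max invr_gt0 ltr0n k_gt0 orbT. Qed.

Lemma ratio_le1 l : ratio l <= 1.
Proof.
case/andP: c01 => c0 c1.
by rewrite ge_max exprn_ile1// invf_le1 ?ltr0n ?k_gt0// ler1n k_gt0.
Qed.

Lemma ratio_le l : ratio l <= c ^+ m + (k l)%:R^-1.
Proof.
case/andP: c01 => c0 c1.
by rewrite ge_max lerDl lerDr invr_ge0 ler0n exprn_ge0.
Qed.

Lemma step_ratio_le l : (step l)%:R * ratio l <= (den l)%:R.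
Proof.
rewrite -ler_pdivlMr ?ratio_gt0//.
by rewrite truncn_le divr_ge0// ltW// ratio_gt0.
Qed.

Lemma step_ratio_ge l : (den l)%:R <= (step l)%:R * ratio l + 1.
Proof.
have x0 : 0 <= (den l)%:R / ratio l by rewrite divr_ge0// ltW// ratio_gt0.
have /andP[_] := truncn_itv x0.
rewrite ltr_pdivrMr ?ratio_gt0// -natr1 mulrDl mul1r => /ltW.
by have := ratio_le1 l; rewrite -/(step l); lra.
Qed.

Lemma den_le_step l : (den l <= step l)%N.
Proof.
rewrite truncn_ge_nat ?divr_ge0 ?(ltW (ratio_gt0 _))//.
by rewrite ler_pdivlMr ?ratio_gt0// ler_piMr// ratio_le1.
Qed.

Lemma step_gt0 l : (0 < step l)%N.
Proof. exact: leq_trans (den_gt0 l) (den_le_step l). Qed.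

Lemma step_le l : (step l <= den l * k l)%N.
Proof.
rewrite -(ler_nat R) natrM -ler_pdivrMr ?ltr0n ?k_gt0//.
apply: le_trans (step_ratio_le l); rewrite ler_wpM2l//.
by rewrite le_max lexx orbT.
Qed.

Lemma step_le_base l : (step l <= base l.+1)%N.
Proof.
apply: leq_trans (step_le l) _; apply: (@leq_trans (den l * base l)).
  by rewrite leq_mul2l ltnW ?orbT// k_lt_base.
by rewrite /den /base -expnSr -expnM leq_pexp2l// mulnC kS.
Qed.

Lemma full_gt0 l : (0 < full l)%N.
Proof. by rewrite muln_gt0 den_gt0 expn_gt0 step_gt0. Qed.

Lemma full_le_den l : (full l <= den l.+1)%N.
Proof.
have dT := den_le_step l; have Tb := step_le_base l.
have -> : den l.+1 = (base l.+1 * base l.+1 ^ m.-1)%N.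
  by rewrite /den -expnS prednK//; lia.
by apply: leq_mul; [exact: leq_trans Tb|rewrite leq_exp2r//; lia].
Qed.

Lemma radius_ge0 l : 0 <= radius l.
Proof. by rewrite invr_ge0. Qed.

Lemma full_radius l : (full l)%:R * radius l = (base l.+1 * k l)%:R^-1.
Proof.
rewrite /radius -mulnA [(_ * (_ * _))%:R]natrM invfM mulrA mulfV ?mul1r//.
by rewrite pnatr_eq0 gtn_eqF// full_gt0.
Qed.

Lemma step_full_radius l : (step l)%:R * ((full l)%:R * radius l) <= (k l)%:R^-1.
Proof.
rewrite full_radius natrM invfM mulrA ler_piMl ?invr_ge0//.
by rewrite ler_pdivrMr ?ltr0n ?base_gt0// mul1r ler_nat step_le_base.
Qed.

Lemma step_den_le_full l : (step l * den l <= full l)%N.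
Proof.
rewrite /full mulnC leq_mul2l -{1}[step l]expn1 leq_pexp2l ?orbT ?step_gt0//.
by have := m_ge2; case: (m) => [|[]].
Qed.

Lemma frac_step_le i (T u : nat) : (0 < T)%N -> (1 <= i)%N -> (u < T ^ (i - 2))%N ->
  0 <= ((T ^ i)%:R^-1 + u%:R / (T * T ^ (i - 2))%:R : R) <= T%:R^-1.
Proof.
move=> T0 i1 hu; rewrite addr_ge0 ?mulr_ge0 ?invr_ge0//=.
case: i i1 hu => [//|[|i]] _.
  by rewrite ltnS leqn0 expn1 => /eqP ->; rewrite mul0r addr0.
rewrite !subSS subn0 => hu.
have Ti : 0 < (T ^ i)%:R :> R by rewrite ltr0n expn_gt0 T0.
have Tr : 0 < T%:R :> R by rewrite ltr0n.
have u1 : u%:R + 1 <= (T ^ i)%:R :> R by rewrite natr1 ler_nat.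
have T1 : T%:R^-1 <= 1 :> R by rewrite invf_le1// ler1n.
have -> : (T ^ i.+2)%:R^-1 = T%:R^-1 * (T%:R^-1 / (T ^ i)%:R) :> R.
  by rewrite !expnS !natrM !invfM.
have -> : u%:R / (T * T ^ i)%:R = T%:R^-1 * (u%:R / (T ^ i)%:R) :> R.
  by rewrite natrM invfM mulrCA mulrA.
rewrite -mulrDr -[leRHS]mulr1 ler_wpM2l ?invr_ge0// -mulrDl ler_pdivrMr// mul1r.
by lra.
Qed.

Lemma den_node l i z u : (u < step l ^ (i - 2))%N ->
  exists w : int,
    0 <= (den l)%:R * node l i z u - w%:~R <= (step l)%:R^-1.
Proof.
move=> hu; have T0 := step_gt0 l.
have D0 : (den l)%:R != 0 :> R by rewrite pnatr_eq0 gtn_eqF// den_gt0.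
have E : (den l)%:R * node l i z u = 2 * z%:~R +
    ((step l ^ i)%:R^-1 + u%:R / (step l * step l ^ (i - 2))%:R) :> R.
  rewrite /node !(natrM _ (den l)) !invfM.
  set p := (step l ^ i)%:R^-1; set q := (step l * _)%:R^-1.
  by field.
have [i0|i1] := leqP i 0.
  move: i0; rewrite leqn0 => /eqP i0; subst i.
  move: hu; rewrite /= ltnS leqn0 => /eqP u0.
  exists (2 * z + 1); rewrite E u0 mul0r addr0 expn0 invr1 intrD intrM (_ : 2%:~R = 2) //.
  by rewrite mulr1z subrr lexx invr_ge0 ler0n.
exists (2 * z); rewrite E intrM (_ : 2%:~R = 2) // addrAC subrr add0r.
exact: frac_step_le.
Qed.


Lemma full_node l i z u : (i < m)%N ->
  exists w : int, (full l)%:R * node l i z u = w%:~R.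
Proof.
move=> im; have T0 := step_gt0 l.
have D0 : (den l)%:R != 0 :> R by rewrite pnatr_eq0 gtn_eqF// den_gt0.
have Tn n : (step l ^ n)%:R != 0 :> R by rewrite pnatr_eq0 gtn_eqF// expn_gt0 T0.
exists (2 * z * (step l ^ m.-1)%:Z + (step l ^ (m.-1 - i))%:Z
  + u%:Z * (step l ^ (m.-1 - (i - 2).+1))%:Z).
rewrite /node /full -expnS !intrD !intrM -!pmulrn !natrM !invfM.
have e1 : (step l ^ m.-1)%:R = (step l ^ (m.-1 - i))%:R * (step l ^ i)%:R :> R.
  by rewrite -natrM -expnD subnK//; lia.
have e2 : (step l ^ m.-1)%:R =
    (step l ^ (m.-1 - (i - 2).+1))%:R * (step l ^ (i - 2).+1)%:R :> R.
  by rewrite -natrM -expnD subnK//; lia.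
rewrite !mulrDr; congr (_ + _ + _).
- by field.
- by rewrite e1; field; rewrite D0 Tn.
- by rewrite e2; field; rewrite D0 Tn.
Qed.

Lemma follows_num (xi : 'rV[R]_m) l (i : 'I_m) (q w : R) (z : int) (u : nat) (b : R) :
  0 <= q -> node l i z u <= xi 0 i <= node l i z u + radius l ->
  0 <= q * node l i z u - w <= b ->
  `|q * xi 0 i - w| <= b + q * radius l.
Proof.
move=> q0 /andP[h1 h2] /andP[h3 h4].
have := ler_wpM2l q0 h1; have := ler_wpM2l q0 h2; rewrite mulrDr => h5 h6.
by rewrite ger0_norm; lra.
Qed.

Lemma psi_le_den (xi : 'rV[R]_m) l Q : follows xi -> (den l)%:R <= Q ->
  psi xi Q <= (step l)%:R^-1 + (den l)%:R * radius l.
Proof.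
move=> F DQ; apply: psi_le DQ _ _; first exact: den_gt0.
  by rewrite addr_ge0 ?mulr_ge0 ?radius_ge0 ?invr_ge0.
move=> i; have [z [u [hu hx]]] := F l i.
have [w hw] := @den_node l i z u hu.
by exists w; exact: follows_num hx hw.
Qed.

Lemma psi_le_full (xi : 'rV[R]_m) l Q : follows xi -> (full l)%:R <= Q ->
  psi xi Q <= (full l)%:R * radius l.
Proof.
move=> F DQ; apply: psi_le DQ _ _; first exact: full_gt0.
  by rewrite mulr_ge0 ?radius_ge0.
move=> i; have [z [u [hu hx]]] := F l i.
have [w hw] := @full_node l i z u (ltn_ord i).
exists w; rewrite -[leRHS]add0r; apply: follows_num hx _ => //.
by rewrite hw subrr lexx.
Qed.

Lemma dvdn_of_close (q w : int) (n : nat) :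
  (0 < n)%N -> `|q%:~R / n%:R - w%:~R : R| < n%:R^-1 -> (n %| `|q|)%N.
Proof.
move=> n0 h; have nr : 0 < n%:R :> R by rewrite ltr0n.
suff e : q = w * n%:Z.
  by have : (n%:Z %| q)%Z; [rewrite e dvdz_mull|rewrite dvdzE].
apply/eqP; rewrite -subr_eq0; apply/eqP/(@int_lt1_eq0 R).
rewrite intrB intrM -!pmulrn.
have -> : q%:~R - w%:~R * n%:R = (q%:~R / n%:R - w%:~R) * n%:R :> R.
  by field; rewrite gt_eqF.
by rewrite normrM (ger0_norm (ltW nr)) -ltr_pdivlMr// mul1r.
Qed.

(** Coordinate 0 is an odd multiple of 1 / den l with den l a power of 2, so q
    brings it closer than 1 / den l to an integer only if den l divides q.
    If den l * step l ^ i divides q, then q times coordinate i.+1 is, modulo 1,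
    a multiple of 1 / step l, and being closer than that to an integer means
    that q has one more factor step l. *)
Lemma full_dvd (xi : 'rV[R]_m) l (q : nat) : follows xi -> (q < full l)%N ->
  (forall i, exists z : int,
     `|q%:R * xi 0 i - z%:~R| < (step l)%:R^-1 - (full l)%:R * radius l) ->
  (full l %| q)%N.
Proof.
move=> F qA H; have T0 := step_gt0 l; have D0 := den_gt0 l.
have Tr : 0 < (step l)%:R :> R by rewrite ltr0n.
have Dr : 0 < (den l)%:R :> R by rewrite ltr0n.
have close (i : 'I_m) : exists z u (w : int), (u < step l ^ (i - 2))%N /\
    `|q%:R * node l i z u - w%:~R| < (step l)%:R^-1.
  have [z [u [hu /andP[h1 h2]]]] := F l i; have [w hw] := H i.
  exists z, u, w; split=> //.
  have q0 : 0 <= q%:R :> R by [].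
  have := ler_wpM2l q0 h1; have := ler_wpM2l q0 h2; rewrite mulrDr => h5 h6.
  have : q%:R * radius l <= (full l)%:R * radius l.
    by rewrite ler_wpM2r ?radius_ge0// ler_nat ltnW.
  have : 0 <= q%:R * radius l by rewrite mulr_ge0 ?radius_ge0.
  move: hw; rewrite !ltr_norml => /andP[h7 h8] h9 h10.
  by apply/andP; split; lra.
(* In coordinate i.+1 the term with u becomes an integer after multiplication
   by q, since step l * step l ^ (i.+1 - 2) divides step l ^ i for i > 0 and
   u = 0 for i = 0. *)
have chain i : (i < m)%N -> (den l * step l ^ i %| q)%N.
  elim: i => [|i IHi] im; have [z [u [w [hu hw]]]] := close (Ordinal im); move: hu hw => /=.
    rewrite expn0 muln1 ltnS leqn0 => /eqP ->.
    have -> : q%:R * node l 0 z 0 = (q%:Z * (2 * z + 1))%:~R / (den l)%:R.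
      rewrite /node mul0r addr0 expn0 muln1 !(intrM, intrD) -!pmulrn; field.
      by rewrite gt_eqF.
    move=> hw; have : `|(q%:Z * (2 * z + 1))%:~R / (den l)%:R - w%:~R : R| < (den l)%:R^-1.
      by apply: lt_le_trans hw _; rewrite lef_pV2 ?posrE// ler_nat den_le_step.
    move/(dvdn_of_close D0); rewrite abszM absz_nat Gauss_dvdl//.
    by rewrite coprimeXl// coprimeXl// coprime2n; lia.
  have /dvdnP[q' qE] := IHi (ltnW im).
  move=> hu hw.
  have [w' ew'] : exists w' : int,
      q%:R * node l i.+1 z u = q'%:Z%:~R / (step l)%:R + w'%:~R.
    have Ti : (step l ^ i)%:R != 0 :> R by rewrite pnatr_eq0 gtn_eqF// expn_gt0 T0.
    rewrite /node qE; case: i hu hw {im IHi qE} Ti => [|i] hu hw Ti.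
      move: hu; rewrite expn0 ltnS leqn0 => /eqP ->.
      exists (2 * z * q'%:Z); rewrite mul0r addr0 muln1 expn1 !intrM -!pmulrn !natrM.
      by field; rewrite !gt_eqF.
    exists (2 * z * q'%:Z * (step l ^ i.+1)%:Z + u%:Z * q'%:Z).
    rewrite !subSS subn0 -expnS [(step l ^ i.+2)%N]expnS !(intrM, intrD) -!pmulrn !natrM.
    by field; rewrite Ti !gt_eqF.
  move: hw; rewrite ew' => hw.
  have : `|q'%:Z%:~R / (step l)%:R - (w - w')%:~R : R| < (step l)%:R^-1.
    by rewrite intrB opprB addrCA addrA [w'%:~R + _]addrC.
  move/(dvdn_of_close T0); rewrite absz_nat => /dvdnP[q'' q''E]; rewrite q''E in qE.
  rewrite qE; apply/dvdnP; exists q''; rewrite expnS; ring.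
by apply: chain; lia.
Qed.

Lemma psi_ge_full (xi : 'rV[R]_m) l Q : follows xi -> 1 <= Q < (full l)%:R ->
  (step l)%:R^-1 - (full l)%:R * radius l <= psi xi Q.
Proof.
move=> F /andP[Q1 QA]; apply: psi_ge => // q q1 qQ.
have qA : (q < full l)%N by rewrite -(ltr_nat R) (le_lt_trans qQ).
apply: contrapT => H; suff /dvdn_leq : (full l %| q)%N by lia.
apply: (full_dvd F qA) => i.
move/forallNP: H => /(_ i)/existsNP[z hz]; exists z.
by rewrite ltNge; apply/negP.
Qed.

Lemma den_mono a b : (a <= b)%N -> (den a <= den b)%N.
Proof.
elim: b => [|b IHb]; first by rewrite leqn0 => /eqP ->.
rewrite leq_eqVlt => /predU1P[->//|]; rewrite ltnS => /IHb h; apply: leq_trans h _.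
by apply: leq_trans (full_le_den b); rewrite /full leq_pmulr// expn_gt0 step_gt0.
Qed.

Lemma den_bracket l0 (Q : R) : (den l0)%:R <= Q ->
  exists2 l, (l0 <= l)%N & (den l)%:R <= Q < (den l.+1)%:R.
Proof.
move=> h0; have ex : exists n, Q < (den n)%:R.
  exists (Num.truncn Q).+1.
  have Q0 : 0 <= Q by apply: le_trans h0.
  have /andP[_ h] := truncn_itv Q0; apply: lt_le_trans h _.
  rewrite ler_nat; apply: leq_trans (base_le_den _).
  exact: ltn_trans (ltnSn _) (ltn_trans (k_gt _) (k_lt_base _)).
have [n hn nmin] := ex_minnP ex.
have l0n : (l0 < n)%N.
  rewrite ltnNge; apply/negP => /den_mono; rewrite -(ler_nat R) => h1.
  by have := le_lt_trans (le_trans h1 h0) hn; rewrite ltxx.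
case: n hn nmin l0n => [//|n] hn nmin l0n.
exists n => //; rewrite hn andbT leNgt.
by apply/negP => /nmin; rewrite ltnn.
Qed.

(** All error terms are continuous functions of 1 / k l, which tends to 0. *)
Lemma near_inv_k (f : R -> R) (y z : R) :
  {for 0, continuous f} -> f 0 = y ->
  (y < z -> exists N : nat, forall l, (N <= l)%N -> f (k l)%:R^-1 < z) /\
  (z < y -> exists N : nat, forall l, (N <= l)%N -> z < f (k l)%:R^-1).
Proof.
move=> cf f0.
have cv : f (harmonic n) @[n --> \oo] --> y.
  by rewrite -f0; apply: continuous_cvg => //; exact: cvg_harmonic.
have kE l : (k l)%:R^-1 = harmonic (k l).-1 :> R by rewrite /= prednK ?k_gt0.
split=> yz.
- have [N _ HN] := cvgr_lt _ cv _ yz; exists N => l Nl; rewrite kE.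
  by apply: HN => /=; apply: leq_trans Nl _; have := k_gt l; lia.
- have [N _ HN] := cvgr_gt _ cv _ yz; exists N => l Nl; rewrite kE.
  by apply: HN => /=; apply: leq_trans Nl _; have := k_gt l; lia.
Qed.

Lemma full_step l : (full l)%:R / (step l)%:R ^+ m = (den l)%:R / (step l)%:R :> R.
Proof.
have T0 : (step l)%:R != 0 :> R by rewrite pnatr_eq0 gtn_eqF// step_gt0.
have -> : (step l)%:R ^+ m = (step l)%:R * (step l)%:R ^+ m.-1 :> R.
  by rewrite -exprS prednK//; lia.
by rewrite /full natrM natrX; field; rewrite T0 expf_neq0.
Qed.

Lemma den_step_ge l : c ^+ m <= (den l)%:R / (step l)%:R.
Proof.
have T0 : 0 < (step l)%:R :> R by rewrite ltr0n step_gt0.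
rewrite ler_pdivlMr// mulrC; apply: le_trans (step_ratio_le l).
by rewrite ler_wpM2l// le_max lexx.
Qed.

Lemma den_step_le l : (den l)%:R / (step l)%:R <= c ^+ m + 2 * (k l)%:R^-1.
Proof.
have T0 : 0 < (step l)%:R :> R by rewrite ltr0n step_gt0.
have k1 : 0 < (k l)%:R :> R by rewrite ltr0n k_gt0.
have : (step l)%:R^-1 <= (k l)%:R^-1 :> R.
  rewrite lef_pV2 ?posrE// ler_nat; apply: leq_trans (den_le_step l).
  exact: leq_trans (ltnW (k_lt_base l)) (base_le_den l).
have := ratio_le l; have := step_ratio_ge l => h1 h2 h3.
apply: (@le_trans _ _ (ratio l + (step l)%:R^-1)); last by lra.
by rewrite ler_pdivrMr// mulrDl mulVf ?gt_eqF// mulrC.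
Qed.

(** On [den l, full l[ the bound for psi is constant, about 1 / step l, so that
    Q^(1/m) psi(Q) is largest at the right end, with value about
    (den l / step l)^(1/m), and this is attained by full_dvd. On
    [full l, den l.+1[ the product is at most 1 / k l, which also gives
    liminf 0. *)
Lemma follows_Fset (xi : 'rV[R]_m) : follows xi -> Fset m c xi.
Proof.
move=> F; case/andP: c01 => c0 c1.
have m0 : (0 < m)%N by lia.
have T0 l : 0 < (step l)%:R :> R by rewrite ltr0n step_gt0.
have D0 l : 0 < (den l)%:R :> R by rewrite ltr0n den_gt0.
have A0 l : 0 < (full l)%:R :> R by rewrite ltr0n full_gt0.
have k1 l : 0 < (k l)%:R^-1 :> R by rewrite invr_gt0 ltr0n k_gt0.
have Ab l Q : 0 <= Q -> Q <= (den l.+1)%:R ->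
    ((full l)%:R * radius l) ^+ m * Q <= (k l)%:R^-1 ^+ m.
  move=> Q0 QD; rewrite full_radius natrM invfM exprMn mulrAC -[leRHS]mul1r.
  rewrite ler_wpM2r ?exprn_ge0 ?invr_ge0// exprVn mulrC ler_pdivrMr.
    by rewrite mul1r -natrX.
  by rewrite exprn_gt0// ltr0n base_gt0.
split.
  move=> e /= e0; split.
  - have ce : c ^+ m < (c + e) ^+ m.
      by rewrite ltr_pXn2r ?nnegrE ?addr_ge0 ?ltrDl// ltW.
    pose f (h : R) := (1 + h) ^+ m * (c ^+ m + 2 * h).
    have [] := @near_inv_k f (c ^+ m) ((c + e) ^+ m).
    + apply: cvgM.
        apply: (@continuous_comp _ _ _ (fun h : R => 1 + h) (fun x => x ^+ m)).
          by apply: cvgD; [exact: cvg_cst|exact: cvg_id].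
        exact: exprn_continuous.
      by apply: cvgD; [exact: cvg_cst|apply: cvgM; [exact: cvg_cst|exact: cvg_id]].
    + by rewrite /f addr0 expr1n mul1r mulr0 addr0.
    move=> /(_ ce)[N1 HN1] _.
    have [] := @near_inv_k id 0 e; [by []|by []|].
    move=> /(_ e0)[N2 HN2] _.
    exists (den (maxn N1 N2))%:R; first by rewrite ler1n den_gt0.
    move=> Q /den_bracket[l]; rewrite geq_max => /andP[/HN1 h1 /HN2 h2] /andP[DQ QD].
    have Q0 : 0 < Q by apply: lt_le_trans DQ.
    have ce0 : 0 <= c + e by rewrite addr_ge0// ltW.
    have [AQ|QA] := leP (full l)%:R Q.
      apply: le_trans (psi_le_full F AQ) _; apply/le_mul_powRN => //.
        by rewrite mulr_ge0 ?radius_ge0.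
      apply: le_trans (Ab _ _ (ltW Q0) (ltW QD)) _.
      rewrite ler_pXn2r ?nnegrE ?(ltW (k1 _))//.
      by apply: ltW; apply: lt_le_trans h2 _; rewrite lerDr.
    apply: le_trans (psi_le_den F DQ) _; apply/le_mul_powRN => //.
      by rewrite addr_ge0 ?mulr_ge0 ?radius_ge0 ?invr_ge0.
    apply: le_trans (ltW h1); rewrite /f.
    have -> : (step l)%:R^-1 + (den l)%:R * radius l =
        (1 + (step l)%:R * (den l)%:R * radius l) / (step l)%:R.
      by field; rewrite gt_eqF.
    rewrite expr_div_n mulrAC -mulrA.
    apply: ler_pM; rewrite ?exprn_ge0 ?addr_ge0 ?mulr_ge0 ?radius_ge0 ?invr_ge0
      ?exprn_ge0 ?(ltW Q0)//.
      rewrite ler_pXn2r ?nnegrE ?addr_ge0 ?mulr_ge0 ?radius_ge0 ?(ltW (k1 _))// lerD2l.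
      rewrite -natrM; apply: (@le_trans _ _ ((full l)%:R * radius l)).
        by rewrite ler_wpM2r ?radius_ge0// ler_nat step_den_le_full.
      rewrite full_radius natrM invfM ler_piMl ?invr_ge0//.
      by rewrite invf_le1 ?ltr0n ?base_gt0// ler1n base_gt0.
    apply: le_trans (den_step_le l); rewrite -full_step ler_wpM2r ?invr_ge0 ?exprn_ge0//.
    exact: ltW.
  - move=> [Q0 Q01 H].
    pose f (h : R) := (1 - h) ^+ m.+1 * c ^+ m.
    have [N HN] : exists N : nat, forall l, (N <= l)%N ->
        0 < c - e -> (c - e) ^+ m < f (k l)%:R^-1.
      have [ce|ce] := leP (c - e) 0; first by exists 0%N.
      have [] := @near_inv_k f (c ^+ m) ((c - e) ^+ m).
      + apply: cvgM; last exact: cvg_cst.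
        apply: (@continuous_comp _ _ _ (fun h : R => 1 - h) (fun x => x ^+ m.+1)).
          by apply: cvgB; [exact: cvg_cst|exact: cvg_id].
        exact: exprn_continuous.
      + by rewrite /f subr0 expr1n mul1r.
      move=> _ []; last by move=> N HN; exists N => l /HN.
      by rewrite ltr_pXn2r ?nnegrE ?(ltW ce)// ltrBlDr ltrDl.
    pose l := (maxn N (Num.truncn Q0).+2).
    have lk := k_gt l; have Al : (k l < full l)%N.
      apply: leq_trans (k_lt_base l) _; apply: leq_trans (base_le_den l) _.
      by rewrite /full leq_pmulr// expn_gt0 step_gt0.
    pose Q : R := (full l).-1%:R.
    have l2 : (Num.truncn Q0 + 2 <= l)%N by rewrite /l; lia.
    have Q0Q : Q0 <= Q.
      have /andP[_ /ltW h] := truncn_itv (le_trans ler01 Q01).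
      by apply: le_trans h _; rewrite ler_nat; lia.
    have Q1 : 1 <= Q by apply: le_trans Q0Q.
    have QA : Q = (full l)%:R - 1.
      by rewrite /Q -[in RHS](prednK (full_gt0 l)) -natr1 addrK.
    have := H Q Q0Q; apply/negP; rewrite -ltNge.
    set h := (k l)%:R^-1 : R.
    have h1 : h < 1 by rewrite /h invf_lt1 ?ltr0n ?k_gt0// ltr1n; lia.
    have xge : (1 - h) / (step l)%:R <= psi xi Q.
      apply: le_trans (@psi_ge_full xi l Q F _); last by rewrite Q1 QA ltrBlDr ltrDl ltr01.
      rewrite ler_pdivrMr// mulrBl mulVf ?gt_eqF// lerD2l lerN2 mulrC.
      exact: step_full_radius.
    apply: lt_le_trans xge; rewrite ltNge; apply/negP => xle.
    have x0 : 0 < (1 - h) / (step l)%:R by rewrite divr_gt0// subr_gt0.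
    have ce : 0 < c - e.
      have := lt_le_trans x0 xle; rewrite pmulr_lgt0// powR_gt0//.
      exact: lt_le_trans Q1.
    have /(_ m0) : (0 < m)%N -> ((1 - h) / (step l)%:R) ^+ m * Q <= (c - e) ^+ m.
      by move=> _; apply/le_mul_powRN => //; [exact: lt_le_trans Q1|exact: ltW|exact: ltW].
    apply/negP; rewrite -ltNge.
    apply: lt_le_trans (HN l (leq_maxl _ _) ce) _.
    have Qge : (1 - h) * (full l)%:R <= Q.
      rewrite QA mulrBl mul1r lerD2l lerN2 /h mulrC ler_pdivlMr ?ltr0n ?k_gt0//.
      by rewrite mul1r ler_nat ltnW.
    rewrite /f -/h exprSr -!mulrA expr_div_n -!mulrA.
    rewrite ler_wpM2l ?exprn_ge0 ?subr_ge0 ?(ltW h1)//.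
    apply: (@le_trans _ _ ((1 - h) * ((full l)%:R / (step l)%:R ^+ m))).
      by rewrite full_step ler_wpM2l ?subr_ge0 ?(ltW h1)// den_step_ge.
    by rewrite mulrCA mulrA mulrC ler_wpM2l ?invr_ge0 ?exprn_ge0// mulrC.
rewrite /Bad /limf_einf /= oppe_gt0 => /ereal_inf_lt[_ [W [M [_ HM]] <-] supW].
have psi_small l : (full l)%:R `^ m%:R^-1 * psi xi (full l)%:R <= (k l)%:R^-1.
  have Am : 0 < (full l)%:R `^ m%:R^-1 :> R by rewrite powR_gt0.
  rewrite mulrC -ler_pdivlMr// -powRN; apply: le_trans (psi_le_full F (lexx _)) _.
  apply/le_mul_powRN; rewrite ?invr_ge0 ?mulr_ge0 ?radius_ge0//.
  by apply: Ab; rewrite ?ler_nat ?full_le_den.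
have kM l : (Num.truncn `|M| <= l)%N -> M < (full l)%:R.
  move=> Ml; apply: le_lt_trans (ler_norm M) _.
  have /andP[_ h] := truncn_itv (normr_ge0 M); apply: lt_le_trans h _.
  rewrite ler_nat; apply: (@leq_trans (den l)); last first.
    by rewrite /full leq_pmulr// expn_gt0 step_gt0.
  apply: leq_trans (base_le_den l); apply: leq_trans (ltnW (k_lt_base l)).
  exact: leq_ltn_trans Ml (k_gt l).
move: supW; set S := ereal_sup _ => S0.
have SE l : (Num.truncn `|M| <= l)%N -> ((- (k l)%:R^-1)%:E <= S)%E.
  move=> /kM/HM Wl.
  apply: (@le_trans _ _ (- ((full l)%:R `^ m%:R^-1 * psi xi (full l)%:R)%:E)%E).
    by rewrite -EFinN lee_fin lerN2.
  by apply: ereal_sup_ubound; exists (full l)%:R.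
case: S S0 SE => [r| |].
- rewrite lte_fin => r0 SE.
  have [] := @near_inv_k id 0 (- r); [by []|by []|].
  rewrite oppr_gt0 => /(_ r0)[N HN] _.
  have := SE _ (leq_maxr N _); rewrite lee_fin lerNl => h.
  by have := le_lt_trans h (HN _ (leq_maxl N _)); rewrite ltxx.
- by [].
- by move=> _ /(_ _ (leqnn _)).
Qed.

End Construction.

(** * The coordinates as Cantor maps *)

Definition alternate (T : Type) (f g : nat -> T) (n : nat) : T :=
  if odd n then g n./2 else f n./2.

Lemma alternate_even (T : Type) (f g : nat -> T) l : alternate f g l.*2 = f l.
Proof. by rewrite /alternate odd_double doubleK. Qed.

Lemma alternate_odd (T : Type) (f g : nat -> T) l : alternate f g l.*2.+1 = g l.
Proof. by rewrite /alternate /= odd_double /= uphalf_double. Qed.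

Lemma even_odd_ind (P : nat -> Prop) :
  (forall l, P l.*2) -> (forall l, P l.*2.+1) -> forall n, P n.
Proof.
by move=> P0 P1 n; rewrite -(odd_double_half n); case: (odd n); rewrite ?add1n ?add0n.
Qed.

Section Coordinate.
Context {R : realType}.
Variables (m : nat) (c : R) (k : nat -> nat) (i : nat).

Local Notation den := (den m k).
Local Notation step := (step m c k).
Local Notation full := (full m c k).
Local Notation radius := (radius m c k).

(** A stage refines twice. On the even levels of the Cantor map an interval of
    length window l is refined by the points of a grid of step 2 / den l; on
    the odd levels an interval of length 1 / (den l * step l) is refined by
    the choice of u in node. *)
Definition window l : R := if l is l'.+1 then radius l' else 1.

Definition grid_count l : nat := Num.truncn ((window l * (den l)%:R - 3) / 2).

(** The grid is common to all intervals of a level, whose left ends need not lie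
    on it: hence the rounding up, which together with the displacement costs
    at most 3 / den l. *)
Definition grid_start l (x : R) : R :=
  2 * (Num.ceil (x * (den l)%:R / 2))%:~R / (den l)%:R
  + ((den l * step l ^ i)%:R)^-1.

Definition branch := alternate grid_count (fun l => (step l ^ (i - 2))%N).
Definition gap : nat -> R := alternate (fun l => 2 / (den l)%:R)
  (fun l => ((den l * (step l * step l ^ (i - 2)))%:R)^-1).
Definition cell_size : nat -> R := alternate window (fun l => ((den l * step l)%:R)^-1).
Definition cell_start : nat -> R -> R := alternate grid_start (fun _ x => x).

Definition coordinate (t : R) : R := cantor_map branch gap cell_start t.

Hypothesis m_ge2 : (2 <= m)%N.
Hypothesis c01 : 0 <= c <= 1.
Hypothesis k0 : (0 < k 0)%N.
Hypothesis kS : forall l, (m.+1 * k l <= k l.+1)%N.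
Hypothesis im : (i < m)%N.
Hypothesis wide : forall l, 10 <= window l * (den l)%:R.

Let D0 l : 0 < (den l)%:R :> R. Proof. by rewrite ltr0n den_gt0. Qed.
Let T0 l : (0 < step l)%N. Proof. exact: step_gt0. Qed.
Let T0r l : 0 < (step l)%:R :> R. Proof. by rewrite ltr0n. Qed.

Lemma window_ge0 l : 0 <= window l.
Proof. by case: l => //= l; exact: radius_ge0. Qed.

Lemma grid_count_itv l :
  window l * (den l)%:R / 4 <= (grid_count l)%:R <= (window l * (den l)%:R - 3) / 2.
Proof.
have w := wide l; set x := window l * _ in w *.
have x0 : 0 <= (x - 3) / 2 by lra.
have /andP[lo] := truncn_itv x0; rewrite -[X in _ < X]natr1 -/(grid_count l) => hi.
by apply/andP; split; [lra|exact: lo].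
Qed.

Lemma branch_gt0 n : (0 < branch n)%N.
Proof.
apply: (even_odd_ind (P := fun n => 0 < branch n)%N) => l; last first.
  by rewrite /branch alternate_odd expn_gt0 T0.
rewrite /branch alternate_even -(ltr_nat R).
by have /andP[+ _] := grid_count_itv l; have := wide l; lra.
Qed.

Lemma gap_gt0 n : 0 < gap n.
Proof.
apply: (even_odd_ind (P := fun n => 0 < gap n)) => l; rewrite /gap.
  by rewrite alternate_even divr_gt0.
by rewrite alternate_odd invr_gt0 ltr0n !muln_gt0 den_gt0 T0 expn_gt0 T0.
Qed.

Lemma cell_size_ge0 n : 0 <= cell_size n.
Proof.
apply: (even_odd_ind (P := fun n => 0 <= cell_size n)) => l; rewrite /cell_size.
  by rewrite alternate_even window_ge0.
by rewrite alternate_odd invr_ge0.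
Qed.

Lemma grid_start_itv l x : x <= grid_start l x <= x + 3 / (den l)%:R.
Proof.
rewrite /grid_start; set d := (den l)%:R; have d0 : 0 < d by exact: D0.
have /andP[lo hi] := ceil_itv (x * d / 2).
have e0 : 0 <= ((den l * step l ^ i)%:R^-1 : R) <= d^-1.
  rewrite invr_ge0 ler0n /= lef_pV2 ?posrE ?ltr0n ?muln_gt0 ?den_gt0 ?expn_gt0 ?T0//.
  by rewrite ler_nat leq_pmulr// expn_gt0 T0.
set e := _^-1 in e0 *; set z := (Num.ceil _)%:~R in lo hi *.
case/andP: e0 => e0 e1.
have h1 : x <= 2 * z / d by rewrite ler_pdivlMr//; lra.
have h2 : 2 * z / d <= x + 2 / d.
  by rewrite ler_pdivrMr// [leRHS]mulrDl divfK ?gt_eqF//; rewrite intrB -/z in lo; lra.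
by apply/andP; split; lra.
Qed.

Lemma cell_start_ge n x : x <= cell_start n x.
Proof.
apply: (even_odd_ind (P := fun n => x <= cell_start n x)) => l; rewrite /cell_start.
  by rewrite alternate_even; case/andP: (grid_start_itv l x).
by rewrite alternate_odd.
Qed.

Lemma gap_odd l : (branch l.*2.+1)%:R * gap l.*2.+1 = ((den l * step l)%:R)^-1.
Proof.
rewrite /branch /gap !alternate_odd mulnA natrM invfM mulrCA mulfV ?mulr1//.
by rewrite pnatr_eq0 gtn_eqF// expn_gt0 T0.
Qed.

Lemma cell_start_le n x : cell_start n x + (branch n)%:R * gap n <= x + cell_size n.
Proof.
apply: (even_odd_ind (P := fun n =>
  cell_start n x + (branch n)%:R * gap n <= x + cell_size n)) => l.
  rewrite /cell_start /branch /gap /cell_size !alternate_even.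
  have /andP[_ h1] := grid_start_itv l x; have /andP[_ h2] := grid_count_itv l.
  have : (grid_count l)%:R * (2 / (den l)%:R) <= window l - 3 / (den l)%:R.
    rewrite mulrA ler_pdivrMr// mulrBl divfK ?gt_eqF//.
    by lra.
  by lra.
by rewrite gap_odd /cell_start /cell_size !alternate_odd.
Qed.

Lemma cell_size_le n : 2 * cell_size n.+1 <= gap n.
Proof.
apply: (even_odd_ind (P := fun n => 2 * cell_size n.+1 <= gap n)) => l.
  rewrite /cell_size /gap alternate_odd alternate_even ler_pM2l//.
  rewrite lef_pV2 ?posrE// ?ltr0n ?muln_gt0 ?den_gt0 ?T0//.
  by rewrite ler_nat leq_pmulr.
rewrite /cell_size /gap alternate_odd -doubleS alternate_even /= /radius.
set a := (den l * _)%N; set b := (full l * _ * _)%N.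
have a0 : (0 < a)%N by rewrite !muln_gt0 den_gt0 T0 expn_gt0 T0.
suff ab : (2 * a <= b)%N.
  rewrite -[2]invrK -invfM lef_pV2 ?posrE ?mulr_gt0 ?invr_gt0 ?ltr0n//; last first.
    by apply: leq_trans ab; rewrite muln_gt0.
  by rewrite mulrC ler_pdivlMr// -natrM ler_nat mulnC.
have kp := k_gt0 m_ge2 k0 kS.
have b2 : (2 <= base k l.+1)%N.
  by rewrite /base -{1}[2%N]expn1 leq_pexp2l.
have af : (a <= full l)%N.
  rewrite /a /full leq_mul2l -expnS leq_pexp2l ?orbT ?T0//; lia.
rewrite /b -mulnA mulnC leq_mul//.
by rewrite -[2%N]muln1 leq_mul.
Qed.

Lemma coordinate_follows t l : 0 <= t ->
  exists z u, (u < step l ^ (i - 2))%N /\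
    node m c k l i z u <= coordinate t <= node m c k l i z u + radius l.
Proof.
move=> t0.
have := cantor_map_itv branch_gt0 gap_gt0 cell_size_ge0 cell_start_ge cell_start_le
  cell_size_le l.*2.+2 t0.
rewrite -/(coordinate t) (cell_leftS _ _ branch_gt0)// (cell_leftS _ _ branch_gt0)//.

set x := cell_left _ _ _ l.*2 t; set d := (_ %% branch l.*2)%N.
set u := (_ %% _)%N.
have -> : cell_size l.*2.+2 = radius l by rewrite /cell_size -doubleS alternate_even.
have uT : (u < step l ^ (i - 2))%N.
  have : (u < branch l.*2.+1)%N by rewrite ltn_mod branch_gt0.
  by rewrite [X in (_ < X)%N]alternate_odd.
set z := Num.ceil (x * (den l)%:R / 2).
suff -> : cell_start l.*2.+1 (cell_start l.*2 x + d%:R * gap l.*2) + u%:R * gap l.*2.+1 =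
    node m c k l i (z + d%:Z) u by exists (z + d%:Z), u.
rewrite /cell_start /gap !alternate_odd !alternate_even /grid_start -/z /node.
rewrite intrD -pmulrn; set p := (den l)%:R^-1.
set q := _^-1; set e := u%:R / _; ring.
Qed.

Lemma cells_even l : cells branch l.+1.*2 =
  (cells branch l.*2.+1 * step l ^ (i - 2))%N.
Proof. by rewrite doubleS cellsS [X in (_ * X)%N]alternate_odd. Qed.

Lemma cells_odd l : cells branch l.*2.+1 = (cells branch l.*2 * grid_count l)%N.
Proof. by rewrite cellsS [X in (_ * X)%N]alternate_even. Qed.

(** The two hypotheses concern the number of intervals right before the choice
    of u and right before the choice of the grid point. *)
Lemma coordinate_holder (s : R) : 0 < s <= 1 ->
  (forall l, 1 <= (cells branch l.*2.+1)%:R * (den l * step l)%:R^-1 `^ s) ->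
  (forall l, 1 <= (cells branch l.+1.*2)%:R * (radius l / 2) `^ s) ->
  forall t t', 0 <= t < 1 -> 0 <= t' < 1 ->
    `|t - t'| <= 8 * `|coordinate t - coordinate t'| `^ s.
Proof.
move=> s01 Hodd Heven t t' t01 t'01.
rewrite (_ : 8 = 4 * 2); last by ring.
apply: (cantor_map_holder branch_gt0 gap_gt0 cell_size_ge0 cell_start_ge
  cell_start_le cell_size_le) => //.
case/andP: s01 => s0 s1.
apply: (even_odd_ind (P := fun n => 1 <= 2 * (cells branch n)%:R *
    ((branch n)%:R * gap n) `^ s)) => l; last first.
  rewrite gap_odd; apply: le_trans (Hodd l) _.
  by rewrite -mulrA ler_peMl ?mulr_ge0 ?powR_ge0 ?ler1n.
have bg : window l / 2 <= (branch l.*2)%:R * gap l.*2.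
  have /andP[h _] := grid_count_itv l.
  rewrite /branch /gap !alternate_even mulrA ler_pdivlMr//; lra.
have mono : (window l / 2) `^ s <= ((branch l.*2)%:R * gap l.*2) `^ s.
  apply: ge0_ler_powR => //; first exact: ltW.
  - by rewrite nnegrE divr_ge0 ?window_ge0.
  - by rewrite nnegrE mulr_ge0 ?(ltW (gap_gt0 _)).
case: l bg mono => [|l] bg mono.
  rewrite /cells big_ord0 mulr1 -ler_pdivrMl// mulr1.
  apply: le_trans mono; rewrite /= mul1r -[leLHS]powRr1//.
  by apply: ger_powR => //; lra.
apply: le_trans (Heven l) _; rewrite -mulrA; apply: le_trans (ler_wpM2l _ mono) _ => //.
by rewrite ler_peMl ?mulr_ge0 ?powR_ge0// ler1n.
Qed.

End Coordinate.

(** * Counting intervals *)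

Section Growth.
Context {R : realType}.
Variables (m : nat) (c : R) (k : nat -> nat) (y eta : R).

Local Notation base := (base k).
Local Notation den := (den m k).
Local Notation step := (step m c k).
Local Notation full := (full m c k).
Local Notation radius := (radius m c k).
Local Notation K l := (k l)%:R.

Hypothesis m_ge2 : (2 <= m)%N.
Hypothesis c01 : 0 <= c <= 1.
Hypothesis k0 : (0 < k 0)%N.
Hypothesis kS : forall l, (m.+1 * k l <= k l.+1)%N.
(** Powers of 2 with real exponents are used throughout; the factors k l are
    absorbed by a small multiple eta of the exponent. *)
Hypothesis k_small : forall l, K l <= 2 `^ (eta * K l).

Let p2D (a b : R) : 2 `^ (a + b) = 2 `^ a * 2 `^ b.
Proof. by rewrite powRD// pnatr_eq0 implybT. Qed.

Let p2le (a b : R) : a <= b -> 2 `^ a <= 2 `^ b.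
Proof. by apply: ler_powR; rewrite ler1n. Qed.

Let p2nat (n : nat) : (2 ^ n)%:R = 2 `^ n%:R :> R.
Proof. by rewrite natrX powR_mulrn. Qed.

Let p2gt0 (a : R) : 0 < 2 `^ a. Proof. exact: powR_gt0. Qed.

Lemma base_powR l : (base l)%:R = 2 `^ K l :> R.
Proof. exact: p2nat. Qed.

Lemma den_powR l : (den l)%:R = 2 `^ (m%:R * K l) :> R.
Proof. by rewrite /den /base -expnM p2nat natrM mulrC. Qed.

Lemma step_powR_ge l : 2 `^ (m%:R * K l) <= (step l)%:R :> R.
Proof. by rewrite -den_powR ler_nat den_le_step. Qed.

Lemma step_powR_le l : (step l)%:R <= 2 `^ (m%:R * K l + eta * K l).
Proof.
rewrite p2D -den_powR.
apply: (@le_trans _ _ (den l * k l)%:R); first by rewrite ler_nat step_le.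
by rewrite natrM ler_wpM2l.
Qed.

Lemma den_step_powR l :
  (den l * step l)%:R <= 2 `^ (2 * m%:R * K l + eta * K l).
Proof.
rewrite natrM.
have -> : 2 * m%:R * K l + eta * K l = m%:R * K l + (m%:R * K l + eta * K l) by ring.
by rewrite p2D den_powR ler_wpM2l ?powR_ge0// step_powR_le.
Qed.

Lemma radius_powR l :
  2 `^ (- (m%:R ^+ 2 * K l + m%:R * eta * K l + K l.+1)) <= radius l.
Proof.
have pos : (0 < full l * base l.+1 * k l)%N.
  exact: (leq_mul (leq_mul (full_gt0 m_ge2 c01 k0 kS l) (base_gt0 k l.+1))
    (k_gt0 m_ge2 k0 kS l)).
rewrite powRN /radius lef_pV2 ?posrE ?p2gt0 ?ltr0n//.
rewrite -[(_ * _ * _)%N]mulnA [(base _ * _)%N]mulnC mulnA natrM p2D base_powR.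
rewrite ler_wpM2r ?powR_ge0// natrM /full natrM natrX.
have mE : m%:R = 1 + m.-1%:R :> R.
  by rewrite -[in LHS](ltn_predK m_ge2) -natr1 addrC.
have -> : m%:R ^+ 2 * K l + m%:R * eta * K l =
    m%:R * K l + m.-1%:R * (m%:R * K l + eta * K l) + eta * K l.
  by rewrite mE; ring.
rewrite !p2D den_powR ler_pM ?mulr_ge0 ?exprn_ge0// ler_wpM2l ?powR_ge0//.
rewrite mulrC powRrM powR_mulrn ?powR_ge0//.
by rewrite lerXn2r ?nnegrE ?powR_ge0// step_powR_le.
Qed.

Hypothesis count0 : y * m%:R * K 0 + 2 <= m%:R * K 0.
Hypothesis wide0 : 4 <= m%:R * K 0 :> R.
Hypothesis wideS : forall l,
  4 <= (m%:R - 1) * K l.+1 - (m%:R ^+ 2 + m%:R * eta) * K l.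
Hypothesis countS : forall l, y * m%:R * K l.+1 + 2 <=
  y * m%:R * K l + (m%:R - 1) * K l.+1 - (m%:R ^+ 2 + m%:R * eta) * K l.

Lemma window_powR l :
  2 `^ ((m%:R - 1) * K l.+1 - (m%:R ^+ 2 + m%:R * eta) * K l)
    <= window m c k l.+1 * (den l.+1)%:R.
Proof.
have -> : (m%:R - 1) * K l.+1 - (m%:R ^+ 2 + m%:R * eta) * K l =
   - (m%:R ^+ 2 * K l + m%:R * eta * K l + K l.+1) + m%:R * K l.+1 by ring.
by rewrite p2D den_powR ler_wpM2r ?powR_ge0//= radius_powR.
Qed.

Lemma window_wide l : 10 <= window m c k l * (den l)%:R.
Proof.
have h : 10 <= 2 `^ 4%:R :> R by rewrite powR_mulrn// -natrX ler_nat.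
case: l => [|l].
  by rewrite /= mul1r den_powR; apply: le_trans h _; exact: p2le.
by apply: le_trans (window_powR l); apply: le_trans h _; exact: p2le.
Qed.

Lemma powR2_div4 (a : R) : 2 `^ a / 4 = 2 `^ (a - 2).
Proof. by rewrite p2D powRN powR_mulrn// -natrX. Qed.

(** The exponent y, relative to den l, is reproduced at the next stage: the
    window of length radius l contains about radius l * den l.+1 points of the
    new grid. *)
Lemma cells_odd_powR (i l : nat) :
  2 `^ (y * m%:R * K l) <= (cells (branch m c k i) l.*2.+1)%:R.
Proof.
elim: l => [|l IHl].
  rewrite cells_odd /cells big_ord0 mul1n.
  have /andP[h _] := grid_count_itv window_wide 0.
  apply: le_trans h; rewrite /= mul1r den_powR powR2_div4.
  by apply: p2le; have := count0; lra.
rewrite cells_odd cells_even !natrM.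
have /andP[h _] := grid_count_itv window_wide l.+1.
have T1 : 1 <= (step l ^ (i - 2))%:R :> R by rewrite ler1n expn_gt0 step_gt0.
apply: (@le_trans _ _ (2 `^ (y * m%:R * K l) * 1 *
    (window m c k l.+1 * (den l.+1)%:R / 4))); last first.
  have a0 : 0 <= 2 `^ (y * m%:R * K l) * 1 by rewrite mulr1 ltW.
  have w0 : 0 <= window m c k l.+1 * (den l.+1)%:R / 4.
    by rewrite divr_ge0// (le_trans _ (window_wide _)).
  by apply: ler_pM a0 w0 _ h; apply: ler_pM => //; exact: ltW.
rewrite mulr1; apply: (@le_trans _ _ (2 `^ (y * m%:R * K l) *
    (2 `^ ((m%:R - 1) * K l.+1 - (m%:R ^+ 2 + m%:R * eta) * K l) / 4))).
  by rewrite powR2_div4 -p2D; apply: p2le; have := countS l; lra.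
rewrite ler_wpM2l ?powR_ge0// ler_wpM2r ?invr_ge0//.
exact: window_powR.
Qed.

Lemma cells_even_powR (i l : nat) :
  2 `^ ((y + (i - 2)%:R) * m%:R * K l) <= (cells (branch m c k i) l.+1.*2)%:R.
Proof.
rewrite cells_even natrM.
have -> : (y + (i - 2)%:R) * m%:R * K l = y * m%:R * K l + (m%:R * K l) * (i - 2)%:R.
  by ring.
rewrite p2D; apply: ler_pM; [exact: powR_ge0|exact: powR_ge0|exact: cells_odd_powR|].
rewrite powRrM powR_mulrn ?powR_ge0// natrX.
by rewrite lerXn2r ?nnegrE ?powR_ge0// step_powR_ge.
Qed.

Lemma coordinate_holder_powR (i : nat) (s : R) : (i < m)%N -> 0 < s <= 1 ->
  (forall l, s * (2 * m%:R + eta) * K l <= y * m%:R * K l) ->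
  (forall l, s * ((m%:R ^+ 2 + m%:R * eta) * K l + K l.+1 + 1)
     <= (y + (i - 2)%:R) * m%:R * K l) ->
  forall t t', 0 <= t < 1 -> 0 <= t' < 1 ->
    `|t - t'| <= 8 * `|coordinate m c k i t - coordinate m c k i t'| `^ s.
Proof.
move=> im s01 Ho He; have /andP[s0 s1] := s01.
apply: coordinate_holder => // [|l|l]; first exact: window_wide.
- apply: (@le_trans _ _ (2 `^ (y * m%:R * K l) *
      (2 `^ (- (2 * m%:R * K l + eta * K l))) `^ s)).
    rewrite -powRrM -p2D -[leLHS](powRr0 2); apply: p2le.
    by have := Ho l; lra.
  apply: ler_pM; [exact: powR_ge0|exact: powR_ge0|exact: cells_odd_powR|].
  apply: ge0_ler_powR; rewrite ?nnegrE ?(ltW s0) ?powR_ge0 ?invr_ge0//.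
  rewrite powRN lef_pV2 ?posrE ?p2gt0 ?ltr0n ?muln_gt0 ?den_gt0 ?step_gt0//.
  exact: den_step_powR.
- apply: (@le_trans _ _ (2 `^ ((y + (i - 2)%:R) * m%:R * K l) *
      (2 `^ (- (m%:R ^+ 2 * K l + m%:R * eta * K l + K l.+1 + 1))) `^ s)).
    rewrite -powRrM -p2D -[leLHS](powRr0 2); apply: p2le.
    by have := He l; lra.
  apply: ler_pM; [exact: powR_ge0|exact: powR_ge0|exact: cells_even_powR|].
  apply: ge0_ler_powR; rewrite ?nnegrE ?(ltW s0) ?powR_ge0 ?divr_ge0 ?radius_ge0//.
  rewrite opprD p2D; apply: ler_pM; [exact: powR_ge0|exact: powR_ge0|exact: radius_powR|].
  by rewrite powRN powRr1.
Qed.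

End Growth.

(** * A dimension bound with free parameters *)

(** 2^(eta n) is the square of exp (b n), which is at least b n; and b^2 n^2 is
    at least n as soon as n is at least 1 / b^2. *)
Lemma linear_le_exp (R : realType) (eta : R) : 0 < eta ->
  exists N : nat, forall n : nat, (N <= n)%N -> n%:R <= 2 `^ (eta * n%:R) :> R.
Proof.
move=> eta0; pose b : R := ln 2 * eta / 2.
have b0 : 0 < b by rewrite !mulr_gt0 ?ln_gt0 ?ltr1n.
exists (Num.truncn (b ^- 2)).+1 => n Nn.
have n0 : 0 <= n%:R :> R by [].
have nb : 1 <= b ^+ 2 * n%:R.
  rewrite -ler_pdivrMl ?exprn_gt0// mulr1.
  have b20 : 0 <= b ^- 2 by rewrite invr_ge0 ltW// exprn_gt0.
  have /andP[_ /ltW h'] := truncn_itv b20.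
  by apply: le_trans h' _; rewrite ler_nat.
have -> : 2 `^ (eta * n%:R) = expR (b * n%:R) ^+ 2.
  rewrite /powR ifF ?pnatr_eq0// expr2 -expRD /b; congr expR.
  by field.
have e1 : b * n%:R <= expR (b * n%:R).
  by apply: le_trans (expR_ge1Dx _); rewrite lerDr.
have bn0 : 0 <= b * n%:R by rewrite mulr_ge0// ltW.
apply: (@le_trans _ _ ((b * n%:R) ^+ 2)); last first.
  by rewrite lerXn2r ?nnegrE ?expR_ge0.
by rewrite exprMn [n%:R ^+ 2]expr2 mulrA -[leLHS]mul1r ler_wpM2r.
Qed.

Fixpoint exponents (R : realType) (a : R) (n0 : nat) (l : nat) : nat :=
  if l is l'.+1 then Num.truncn (a * (exponents a n0 l')%:R) else n0.

(** Put D = den l and let den l.+1 be about D^(C m). A window of length about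
    D^-(m + C) contains about D^(C m - m - C) points of the next grid, so that
    D^y intervals become D^(y + C m - m - C), which is at least D^(C m y) if
    y (C m - 1) <= C (m - 1) - m. The conditions on s i compare the number of
    intervals with the scales D^-2 and D^-(m + C), the latter after the choice
    of u has contributed D^(i - 2). The slack d pays for factors k l and for
    roundings, provided that the first exponent is large. *)
Lemma Fset_dim_ge (R : realType) (m : nat) (c C y d : R) (s : nat -> R) :
  (2 <= m)%N -> 0 <= c <= 1 -> 0 < d -> 0 <= y -> m%:R <= C * (m%:R - 1) ->
  y * (C * m%:R - 1) + d <= C * (m%:R - 1) - m%:R ->
  (forall i, 0 <= s i) ->
  (forall i, (i < m)%N -> 2 * s i + d <= y) ->
  (forall i, (i < m)%N -> s i * (m%:R + C) + d <= y + (i - 2)%:R) ->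
  ((\sum_(i < m) s i)%:E <= hausdorff_dim (Fset m c))%E.
Proof.
move=> m2 c01 d0 y0 hC hy s0 hs1 hs2.
pose eta := d / 2; have eta0 : 0 < eta by rewrite divr_gt0.
have [N HN] := linear_le_exp eta0.
pose n0 := maxn N (maxn 2 (Num.truncn (12 / d)).+1).
pose k := exponents (C * m%:R) n0.
have mr : 2 <= m%:R :> R by rewrite ler_nat.
have Cm : m%:R + 1 <= C * m%:R.
  rewrite -(@ler_pM2r _ (m%:R - 1)); last by lra.
  have : m%:R * m%:R <= m%:R * (C * (m%:R - 1)) by rewrite ler_wpM2l.
  by lra.
have k_lo l : (m.+1 * k l <= k l.+1)%N.
  rewrite /= truncn_ge_nat; last by rewrite mulr_ge0//; lra.
  by rewrite natrM -natr1 ler_wpM2r.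
have k_itv l : C * m%:R * (k l)%:R - 1 <= (k l.+1)%:R <= C * m%:R * (k l)%:R.
  have h : 0 <= C * m%:R * (k l)%:R by rewrite mulr_ge0//; lra.
  by have /andP[-> ] := truncn_itv h; rewrite -natr1 /= => ?; lra.
have k_n0 l : (n0 <= k l)%N.
  by elim: l => // l IHl; apply: leq_trans IHl _; apply: leq_trans (k_lo l); nia.
have k2 l : 2 <= (k l)%:R :> R.
  by rewrite ler_nat; apply: leq_trans (k_n0 l); rewrite /n0; lia.
have kd l : 12 <= (k l)%:R * d.
  rewrite -ler_pdivrMr//.
  have h : 0 <= 12 / d by rewrite divr_ge0// ltW.
  have /andP[_ /ltW h'] := truncn_itv h; apply: le_trans h' _.
  by rewrite ler_nat; apply: leq_trans (k_n0 l); rewrite /n0; lia.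
have k00 : (0 < k 0)%N by rewrite -(ltr_nat R); have := k2 0; lra.
have ksmall l : (k l)%:R <= 2 `^ (eta * (k l)%:R).
  by apply: HN; apply: leq_trans (k_n0 l); rewrite /n0; lia.
have ym : y * m%:R <= m%:R - 1.
  rewrite -(@ler_pM2r _ (C * m%:R - 1)); last by lra.
  have : m%:R * (y * (C * m%:R - 1) + d) <= m%:R * (C * (m%:R - 1) - m%:R).
    by rewrite ler_wpM2l.
  have : 0 <= m%:R * d by rewrite mulr_ge0// ltW.
  have : 2 * m%:R <= m%:R * m%:R :> R by rewrite ler_wpM2r.
  by lra.
have gain l : m%:R * (k l)%:R * (y * (C * m%:R - 1) + d) <=
    m%:R * (k l)%:R * (C * (m%:R - 1) - m%:R) by rewrite ler_wpM2l// mulr_ge0.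
have mkd l : 12 * m%:R <= m%:R * ((k l)%:R * d).
  by rewrite [leLHS]mulrC ler_wpM2l.
have count0 : y * m%:R * (k 0)%:R + 2 <= m%:R * (k 0)%:R.
  have : y * m%:R * (k 0)%:R <= (m%:R - 1) * (k 0)%:R by rewrite ler_wpM2r.
  by have := k2 0; lra.
have wide0 : 4 <= m%:R * (k 0)%:R :> R.
  by rewrite (_ : 4 = 2 * 2); [exact: ler_pM|ring].
have countS l : y * m%:R * (k l.+1)%:R + 2 <=
    y * m%:R * (k l)%:R + (m%:R - 1) * (k l.+1)%:R
    - (m%:R ^+ 2 + m%:R * eta) * (k l)%:R.
  have /andP[h _] := k_itv l.
  have : (m%:R - 1 - y * m%:R) * (C * m%:R * (k l)%:R - 1) <=
      (m%:R - 1 - y * m%:R) * (k l.+1)%:R by rewrite ler_wpM2l//; lra.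
  have := gain l; have := mkd l; have : 0 <= y * m%:R by rewrite mulr_ge0.
  by rewrite /eta; move=> ? ? ? ?; lra.
have wideS l : 4 <= (m%:R - 1) * (k l.+1)%:R
    - (m%:R ^+ 2 + m%:R * eta) * (k l)%:R.
  have /andP[h _] := k_itv l.
  have : (m%:R - 1) * (C * m%:R * (k l)%:R - 1) <= (m%:R - 1) * (k l.+1)%:R.
    by rewrite ler_wpM2l//; lra.
  have : 0 <= m%:R * (k l)%:R * (y * (C * m%:R - 1)).
    by rewrite !mulr_ge0//; lra.
  have := gain l; have := mkd l.
  by rewrite /eta; move=> ? ? ? ?; lra.
have wide := window_wide m2 c01 k00 k_lo ksmall wide0 wideS.
apply: (@hausdorff_dim_ge_holder _ _ _ _ 8 (coordinate m c k)) => //.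
- move=> i t t' im t01 t'01.
  have [si|si] := eqVneq (s i) 0.
    rewrite si powRr0 mulr1 ler_distl.
    by case/andP: t01 => ? ?; case/andP: t'01 => ? ?; apply/andP; split; lra.
  have sp : 0 < s i by rewrite lt_def si s0.
  have s1 : s i <= 1.
    have y1 : y <= 1.
      by rewrite -(@ler_pM2r _ m%:R) ?mul1r; lra.
    by have := hs1 i im; lra.
  apply: (@coordinate_holder_powR _ m c k y eta) => //; first by rewrite sp s1.
  + move=> l.
    have : m%:R * (k l)%:R * (2 * s i + d) <= m%:R * (k l)%:R * y.
      by rewrite ler_wpM2l ?hs1// mulr_ge0.
    have : s i * ((k l)%:R * d) <= 1 * ((k l)%:R * d).
      by rewrite ler_wpM2r// mulr_ge0// ltW.
    have : 2 * ((k l)%:R * d) <= m%:R * ((k l)%:R * d).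
      by rewrite ler_wpM2r// mulr_ge0// ltW.
    by have := kd l; rewrite /eta; move=> ? ? ? ?; lra.
  + move=> l; have /andP[_ h] := k_itv l.
    have : m%:R * (k l)%:R * (s i * (m%:R + C) + d) <= m%:R * (k l)%:R * (y + (i - 2)%:R).
      by rewrite ler_wpM2l ?hs2// mulr_ge0.
    have : s i * (k l.+1)%:R <= s i * (C * m%:R * (k l)%:R) by rewrite ler_wpM2l.
    have : s i * (m%:R * ((k l)%:R * d)) <= 1 * (m%:R * ((k l)%:R * d)).
      by rewrite ler_wpM2r// !mulr_ge0// ltW.
    by have := mkd l; rewrite /eta; move=> ? ? ? ?; lra.
- move=> t t01; apply: (follows_Fset m2 c01 k00 k_lo) => l i.
  rewrite mxE; apply: coordinate_follows => //.
  by case/andP: (t01 i).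
Qed.

(** * The two bounds *)

Lemma hausdorff_dim_ge0 (R : realType) (V : normedModType R) (A : set V) :
  (0 <= hausdorff_dim A)%E.
Proof. by apply: le_ereal_inf_tmp => _ [s [s0 _] <-]; rewrite lee_fin. Qed.

(** For C = t the quantity C (m - 1) - m is the square root in dim_bound, and the
    largest common exponent y / (m + C) is dim_bound m / m. As Fset_dim_ge needs
    strict inequalities, this value is approached from below. *)
Lemma dim_bound_ge (R : realType) (m : nat) (c : R) : (2 <= m)%N -> 0 <= c <= 1 ->
  ((dim_bound m : R)%:E <= hausdorff_dim (Fset m c))%E /\ 0 < (dim_bound m : R).
Proof.
move=> m2 c01; have mr : 2 <= m%:R :> R by rewrite ler_nat.
rewrite /dim_bound; set M : R := m%:R in mr *.
set q := Num.sqrt _; set t := (M + q) / (M - 1); set b := q / _.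
have q0 : 0 < q.
  have M2 : 2 * M <= M * M by rewrite ler_wpM2r//; lra.
  by rewrite sqrtr_gt0 mulr_gt0 ?expr2//; lra.
have tE : t * (M - 1) = M + q by rewrite /t divfK// gt_eqF//; lra.
have t1 : 1 < t by rewrite /t ltr_pdivlMr; lra.
have Mt : M <= M * t by rewrite ler_peMr//; lra.
have M1 : M^-1 <= 1 by rewrite invf_le1; lra.
have tt : 1 < t ^+ 2 by rewrite expr_gt1//; lra.
have dn : 0 < t ^+ 2 + (M - M^-1) * t - 1.
  have h : 0 <= (M - M^-1) * t by rewrite mulr_ge0//; lra.
  by lra.
have tM : 0 < t * M - 1 by lra.
have M0 : M != 0 by rewrite gt_eqF; lra.
have dE : M * (t ^+ 2 + (M - M^-1) * t - 1) = (t * M - 1) * (M + t) by field.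
have bE : b * (M + t) = M * (q / (t * M - 1)).
  rewrite /b [LHS]mulrAC [RHS]mulrA.
  apply/eqP; rewrite eqr_div ?lt0r_neq0//; apply/eqP.
  by rewrite -mulrA [(M + t) * _]mulrC -dE; ring.
have b0 : 0 < b by rewrite divr_gt0.
split=> //.
apply/lee_addgt0Pr => e e0.
pose D := Num.max (b - e) (b / 2).
have D0 : 0 <= D by rewrite le_max; apply/orP; right; lra.
have Db : D < b by rewrite gt_max; apply/andP; split; lra.
have bD : b <= D + e.
  have h : b - e <= D by rewrite le_max lexx.
  by lra.
apply: (@le_trans _ _ (D + e)%:E); first by rewrite lee_fin.
rewrite EFinD leeD2r//.
have -> : D = \sum_(i < m) (D / M).
  by rewrite sumr_const card_ord -[RHS]mulr_natr divfK// gt_eqF//; rewrite -/M; lra.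
pose y0 := q / (t * M - 1); pose s1 := D / M.
have s1y : s1 * (M + t) < y0.
  rewrite -(@ltr_pM2l _ M); last by lra.
  rewrite -bE mulrA [M * _]mulrC divfK ?gt_eqF; [|lra..].
  by rewrite ltr_pM2r//; lra.
have s10 : 0 <= s1 by rewrite divr_ge0//; lra.
pose y := (s1 * (M + t) + y0) / 2.
have y0E : y0 * (t * M - 1) = q by rewrite divfK// gt_eqF.
have s12 : s1 * 2 <= s1 * (M + t) by rewrite ler_wpM2l//; lra.
pose d := Num.min ((y0 - y) * (t * M - 1)) (y - s1 * (M + t)).
have dl : d <= (y0 - y) * (t * M - 1) by rewrite ge_min lexx.
have dr : d <= y - s1 * (M + t) by rewrite ge_min lexx orbT.
apply: (@Fset_dim_ge R m c t y d (fun=> D / M)) => //; rewrite -?/M -/s1.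
- rewrite lt_min mulr_gt0 ?subr_gt0//=; rewrite /y; lra.
- have h : 0 <= s1 * (M + t) by rewrite mulr_ge0//; lra.
  by rewrite /y; lra.
- by rewrite tE; lra.
- by rewrite tE; lra.
- by move=> _ _; lra.
- move=> i _; have h : 0 <= (i - 2)%:R :> R by [].
  by rewrite /y in dr *; lra.
Qed.

(** Comparison with x^2 / 2 + x, which grows by at least x between x - 1 and x
    when x >= 0. *)
Lemma sum_max0_sub (R : realType) (n : nat) (a : R) : 0 <= a ->
  \sum_(i < n) Num.max 0 (a - i%:R) <= a ^+ 2 / 2 + a.
Proof.
move=> a0.
pose g (x : R) := Num.max 0 x ^+ 2 / 2 + Num.max 0 x.
have g0 x : 0 <= g x.
  by rewrite addr_ge0 ?divr_ge0 ?exprn_ge0// le_max lexx.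
have gS x : Num.max 0 x + g (x - 1) <= g x.
  rewrite /g; have [x0|x0] := leP x 0; have [x1|x1] := leP (x - 1) 0.
  - by rewrite expr0n/=; lra.
  - by lra.
  - have := sqr_ge0 x; rewrite expr0n/=; lra.
  - by rewrite !expr2; lra.
suff H : \sum_(i < n) Num.max 0 (a - i%:R) + g (a - n%:R) <= g a.
  have := g0 (a - n%:R); move: H; rewrite {2}/g (max_idPr a0); lra.
elim: n => [|n IHn]; first by rewrite big_ord0 add0r subr0.
rewrite big_ord_recr /= -addrA; apply: le_trans IHn; rewrite lerD2l.
by apply: le_trans (gS _); rewrite lerD2l -natr1 opprD addrA.
Qed.

(** For C = sqrt m the admissible y is at least 1 - 2 / sqrt m, and the exponent
    min(1/2, i/m) - 4 / sqrt m meets both conditions of Fset_dim_ge whenever it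
    is positive. *)
Lemma dim_three_eighths (R : realType) (m : nat) (c : R) : (2 <= m)%N -> 0 <= c <= 1 ->
  ((3 / 8 * m%:R - (1 / 2 + 4 * Num.sqrt m%:R))%:E <= hausdorff_dim (Fset m c))%E.
Proof.
move=> m2 c01; set q : R := Num.sqrt m%:R.
have q0 : 0 <= q by rewrite sqrtr_ge0.
have mE : m%:R = q ^+ 2 by rewrite sqr_sqrtr.
(* For sqrt m <= 8 the lower bound is negative. *)
have [q8|q8] := leP q 8.
  apply: le_trans (hausdorff_dim_ge0 _); rewrite lee_fin mE expr2.
  have h : q * q <= 8 * q by rewrite ler_wpM2r.
  by lra.
have qp : 0 < q by lra.
have iq0 : 0 < q^-1 by rewrite invr_gt0.
have iq : q^-1 <= 1 / 8 by rewrite -div1r ler_pdivrMr//; lra.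
have qV : q * q^-1 = 1 by rewrite mulfV// gt_eqF.
pose s i : R := if (i < m)%N then Num.max 0 (Num.min (1 / 2) (i%:R / m%:R) - 4 * q^-1) else 0.
have m0 : 0 < m%:R :> R by rewrite mE exprn_gt0.
apply: (@le_trans _ _ (\sum_(i < m) s i)%:E).
  rewrite lee_fin.
  have term (i : 'I_m) : 1 / 2 - Num.max 0 (m%:R / 2 - i%:R) / m%:R - 4 * q^-1 <= s i.
    rewrite /s ltn_ord le_max; apply/orP; right; rewrite lerD2r.
    rewrite le_min; apply/andP; split.
      by rewrite gerDl oppr_le0 divr_ge0// ?le_max ?lexx// ltW.
    rewrite lerBlDr -mulrDl ler_pdivlMr//.
    have h : m%:R / 2 - i%:R <= Num.max 0 (m%:R / 2 - i%:R) :> R.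
      by rewrite le_max lexx orbT.
    by lra.
  apply: le_trans (ler_sum _ (fun i _ => term i)).
  rewrite !sumrB !sumr_const card_ord -mulr_suml.
  have m20 : 0 <= m%:R / 2 :> R by rewrite divr_ge0.
  have := @sum_max0_sub R m _ m20; set S := \sum_(i < m) _ => hS.
  have hSm : S / m%:R <= m%:R / 8 + 1 / 2.
    by rewrite ler_pdivrMr//; move: hS; rewrite expr2; lra.
  have hq : 4 * q^-1 * m%:R = 4 * q.
    by rewrite mE expr2 mulrA -[4 * _ * q]mulrA [q^-1 * q]mulrC qV; ring.
  by rewrite -[1 / 2 *+ m]mulr_natr -[4 / q *+ m]mulr_natr hq; lra.
have s_case (i : nat) : s i = 0 \/ (s i <= 1 / 2 - 4 * q^-1 /\ s i <= i%:R / m%:R - 4 * q^-1).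
  rewrite /s; case: ifP => _; last by left.
  set z := Num.min _ _ - _; have [z0|z0] := leP z 0; first by left.
  right; rewrite /z; split; rewrite lerD2r ge_min lexx ?orbT//.
have s0 i : 0 <= s i by rewrite /s; case: ifP => // _; rewrite le_max lexx.
apply: (@Fset_dim_ge R m c q (1 - 2 * q^-1) q^-1 s) => //.
- by lra.
- have h : 8 * q <= q * q by rewrite ler_wpM2r// ltW.
  have h2 : 8 * (q * q) <= q * (q * q) by rewrite ler_wpM2r ?mulr_ge0// ltW.
  by rewrite mE expr2; lra.
- have h : 8 * q <= q * q by rewrite ler_wpM2r// ltW.
  have e1 : q^-1 * (q * q * q) = q * q by rewrite -mulrA mulKf// gt_eqF.
  by rewrite mE expr2; lra.
- by move=> i im; have [->|[h1 _]] := s_case i; lra.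
- move=> i im; have [->|[_ h1]] := s_case i.
    have h : 0 <= (i - 2)%:R :> R by [].
    by lra.
  have h2 : i%:R - 2 <= (i - 2)%:R :> R.
    by rewrite lerBlDr -natrD ler_nat; lia.
  have im1 : i%:R / m%:R * (q * q) = i%:R by rewrite -expr2 -mE divfK// gt_eqF.
  have im2 : i%:R / m%:R * q <= q.
    rewrite -[leRHS]mul1r ler_wpM2r// ler_pdivrMr// mul1r ler_nat ltnW//.
  have : s i * (q * q + q) <= (i%:R / m%:R - 4 * q^-1) * (q * q + q).
    by rewrite ler_wpM2r// addr_ge0 ?mulr_ge0.
  have e2 : q^-1 * (q * q + q) = q + 1 by rewrite mulrDr mulrA mulVf ?gt_eqF// mul1r.
  rewrite mulrBl [i%:R / m%:R * _]mulrDr im1 -[4 / q * _]mulrA e2.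
  by rewrite [X in s i * (X + q) + _]mE expr2 => h3; lra.
Qed.

Lemma littleo_sqrt (R : realType) :
  (fun m : nat => 1 / 2 + 4 * Num.sqrt m%:R : R) =o_\oo (fun m : nat => m%:R : R).
Proof.
apply/eqoP => eps eps0.
near=> n.
have n1 : (1 : R) <= n%:R by rewrite ler1n; near: n; exists 1%N.
have h : (5 / eps) ^+ 2 <= n%:R.
  near: n; exists (Num.truncn ((5 / eps) ^+ 2)).+1 => // n /= Nn.
  have /andP[_ /ltW h'] := truncn_itv (sqr_ge0 (5 / eps)).
  by apply: le_trans h' _; rewrite ler_nat.
set q := Num.sqrt n%:R.
have q0 : 0 <= q by rewrite sqrtr_ge0.
have nE : n%:R = q ^+ 2 by rewrite sqr_sqrtr.
have q1 : 1 <= q by rewrite -(ler_pXn2r (n := 2)) ?nnegrE// expr1n -nE.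
have qe : 5 / eps <= q.
  by rewrite -(ler_pXn2r (n := 2)) ?nnegrE -?nE// divr_ge0// ltW.
rewrite ger0_norm; last by lra.
rewrite ger0_norm// nE expr2 mulrA.
have : 5 <= eps * q by rewrite mulrC -ler_pdivrMr.
move=> h5; apply: (@le_trans _ _ (5 * q)); first by lra.
by rewrite ler_wpM2r.
Unshelve. all: by end_near. Qed.

Theorem theorem2p3 (R : realType) :
  (forall (m : nat) (c : R), (2 <= m)%N -> 0 <= c <= 1 ->
     ((dim_bound m : R)%:E <= hausdorff_dim (Fset m c))%E /\ 0 < (dim_bound m : R)) /\
  (exists e : nat -> R, e =o_\oo (fun m : nat => m%:R : R) /\
     forall (m : nat) (c : R), (2 <= m)%N -> 0 < c <= 1 ->
       ((3 / 8 * m%:R - e m)%:E <= hausdorff_dim (Fset m c))%E).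
Proof.
split; first exact: dim_bound_ge.
exists (fun m => 1 / 2 + 4 * Num.sqrt m%:R); split; first exact: littleo_sqrt.
move=> m c m2 /andP[c0 c1]; apply: dim_three_eighths => //.
by rewrite (ltW c0).
Qed.
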